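(* Let $\mathcal{A}$ be a small abelian category and let $\mathcal{C}\subseteq\mathcal{A}$ be a full additive, strictly full, Karoubi closed subcategory which is $\mathcal{A}$-approximating. If $\mathcal{A}$ has finite $\mathcal{C}$-dimension $n$, then $\mathcal{H}_{\mathcal{C}}$ has finite cohomological dimension $\leq n+2$. Conversely, the $\mathcal{C}$-dimension of $\mathcal{A}$ is bounded by the cohomological dimension of $\mathcal{H}_{\mathcal{C}}$.
   Context: Strictly full means closed under isomorphisms; Karoubi closed means closed under direct summands in $\mathcal{A}$. $\mathcal{T}_{\mathcal{C}}=K^-(\mathcal{C})$ (bounded above cochain complexes modulo homotopy) is a full triangulated subcategory of $\mathcal{T}_{\mathcal{A}}=K^-(\mathcal{A})$. A $\mathcal{C}$-approximation of $X\in\mathcal{T}_{\mathcal{A}}$ is a quasi-isomorphism $X_{\mathcal{C}}\to X$ with $X_{\mathcal{C}}\in\mathcal{T}_{\mathcal{C}}$ inducing an isomorphism $\mathrm{Hom}_{\mathcal{T}_{\mathcal{C}}}(-,X_{\mathcal{C}})\to\mathrm{Hom}_{\mathcal{T}_{\mathcal{A}}}(-,X)|_{\mathcal{T}_{\mathcal{C}}}$. $\mathcal{C}$ is $\mathcal{A}$-approximating if every $X\in\mathcal{T}_{\mathcal{A}}$ has a $\mathcal{C}$-approximation. A $\mathcal{C}$-resolution of $M\in\mathcal{A}$ is an exact sequence $\cdots\to C^{-1}\to C^0\to M\to 0$ with $C^i\in\mathcal{C}$ such that $\cdots\to\mathrm{Hom}_{\mathcal{C}}(-,C^{-1})\to\mathrm{Hom}_{\mathcal{C}}(-,C^0)\to\mathrm{Hom}_{\mathcal{A}}(-,M)|_{\mathcal{C}}\to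 0$ is exact. The $\mathcal{C}$-dimension of $M$ is the smallest $n\in\mathbb{N}\cup\{\infty\}$ such that $M$ has a $\mathcal{C}$-resolution $0\to C^{-n}\to\cdots\to C^0\to M\to 0$; the $\mathcal{C}$-dimension of $\mathcal{A}$ is the supremum of the $\mathcal{C}$-dimensions of its objects. $\mathcal{T}^{\leq 0}_{\mathcal{C}}$ is the strictly full subcategory of $\mathcal{T}_{\mathcal{C}}$ generated by complexes $X$ with $X^i=0$ for $i>0$; it is the $\leq 0$ part of a $t$-structure with $\mathcal{T}^{\geq 0}_{\mathcal{C}}=\{X\in\mathcal{T}_{\mathcal{C}}\mid\mathrm{Hom}(\mathcal{T}^{\leq 0}_{\mathcal{C}}[1],X)=0\}$; $\mathcal{H}_{\mathcal{C}}=\mathcal{T}^{\leq 0}_{\mathcal{C}}\cap\mathcal{T}^{\geq 0}_{\mathcal{C}}$ is its heart, an abelian category (with enough projectives). *)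

(* Defs.v *)
From HB Require Import structures.
From mathcomp Require Import all_boot all_order all_algebra.
From mathcomp Require Import generic_quotient ring_quotient boolp.
From Stdlib Require Import Relations.

Set Implicit Arguments.
Unset Strict Implicit.
Unset Printing Implicit Defensive.

Import Order.TTheory GRing.Theory Num.Theory.
Local Open Scope ring_scope.

Declare Scope cat_scope.
Delimit Scope cat_scope with cat.

(* Sets of objects are types and equality of morphisms is Leibniz equality, so
   every category below is small. *)
Record preadditive := Preadditive {
  ob :> Type;
  hom : ob -> ob -> zmodType;
  idm : forall X, hom X X;
  comp : forall X Y Z, hom Y Z -> hom X Y -> hom X Z;
  comp1m : forall X Y (f : hom X Y), comp (idm Y) f = f;
  compm1 : forall X Y (f : hom X Y), comp f (idm X) = f;
  compA : forall X Y Z W (h : hom Z W) (g : hom Y Z) (f : hom X Y),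
    comp h (comp g f) = comp (comp h g) f;
  compDl : forall X Y Z (g g' : hom Y Z) (f : hom X Y),
    comp (g + g') f = comp g f + comp g' f;
  compDr : forall X Y Z (g : hom Y Z) (f f' : hom X Y),
    comp g (f + f') = comp g f + comp g f'
}.
Arguments hom {p} X Y.
Arguments idm {p} X.
Arguments comp {p X Y Z} g f.

Notation "g \oc f" := (comp g f) (at level 40, left associativity) : cat_scope.
Local Open Scope cat_scope.

Section PreadditiveTheory.
Variable B : preadditive.

Lemma comp0m (X Y Z : B) (f : hom X Y) : (0 : hom Y Z) \oc f = 0.
Proof. by apply: (addIr ((0 : hom Y Z) \oc f)); rewrite -compDl !add0r. Qed.

Lemma compm0 (X Y Z : B) (g : hom Y Z) : g \oc (0 : hom X Y) = 0.
Proof. by apply: (addIr (g \oc (0 : hom X Y))); rewrite -compDr !add0r. Qed.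

Lemma compNm (X Y Z : B) (g : hom Y Z) (f : hom X Y) :
  (- g) \oc f = - (g \oc f).
Proof. by apply: (addIr (g \oc f)); rewrite -compDl !addNr comp0m. Qed.

Lemma compmN (X Y Z : B) (g : hom Y Z) (f : hom X Y) :
  g \oc (- f) = - (g \oc f).
Proof. by apply: (addIr (g \oc f)); rewrite -compDr !addNr compm0. Qed.

Definition is_iso (X Y : B) (f : hom X Y) : Prop :=
  exists g : hom Y X, g \oc f = idm X /\ f \oc g = idm Y.

Definition isomorphic (X Y : B) : Prop := exists f : hom X Y, is_iso f.

Definition monic (X Y : B) (f : hom X Y) : Prop :=
  forall Z (g h : hom Z X), f \oc g = f \oc h -> g = h.

Definition epic (X Y : B) (f : hom X Y) : Prop :=
  forall Z (g h : hom Y Z), g \oc f = h \oc f -> g = h.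

Definition zero_object (X : B) : Prop :=
  (forall Y (f g : hom X Y), f = g) /\ (forall Y (f g : hom Y X), f = g).

Definition is_biproduct (X Y S : B) (i1 : hom X S) (i2 : hom Y S)
    (p1 : hom S X) (p2 : hom S Y) : Prop :=
  [/\ p1 \oc i1 = idm X, p2 \oc i2 = idm Y, p1 \oc i2 = 0, p2 \oc i1 = 0
    & i1 \oc p1 + i2 \oc p2 = idm S].

Definition biproduct (X Y S : B) : Prop :=
  exists i1 i2 p1 p2, @is_biproduct X Y S i1 i2 p1 p2.

Definition is_kernel (X Y K : B) (f : hom X Y) (k : hom K X) : Prop :=
  f \oc k = 0 /\
  forall Z (g : hom Z X), f \oc g = 0 -> exists! u : hom Z K, k \oc u = g.

Definition is_cokernel (X Y Q : B) (f : hom X Y) (q : hom Y Q) : Prop :=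
  q \oc f = 0 /\
  forall Z (g : hom Y Z), g \oc f = 0 -> exists! u : hom Q Z, u \oc q = g.

(* [f] corestricts to an epimorphism onto the kernel of [g]; the intended use
   is in an abelian category. *)
Definition exact (X Y Z : B) (f : hom X Y) (g : hom Y Z) : Prop :=
  exists (K : B) (k : hom K Y) (e : hom X K),
    [/\ is_kernel g k, epic e & k \oc e = f].

Record kernel (X Y : B) (f : hom X Y) := Kernel {
  ker_ob : B; ker_map : hom ker_ob X; ker_mapP : is_kernel f ker_map }.

Record cokernel (X Y : B) (f : hom X Y) := Cokernel {
  coker_ob : B; coker_map : hom Y coker_ob; coker_mapP : is_cokernel f coker_map }.

Section Lifts.
Variables (X Y : B) (f : hom X Y).

Lemma ker_lift_ex (k : kernel f) Z (g : hom Z X) :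
  f \oc g = 0 -> exists u : hom Z (ker_ob k), ker_map k \oc u = g.
Proof. by move=> /(proj2 (ker_mapP k) Z g)[u [uE _]]; exists u. Qed.

Definition ker_lift (k : kernel f) Z (g : hom Z X) (fg0 : f \oc g = 0) :
  hom Z (ker_ob k) := projT1 (cid (ker_lift_ex k fg0)).

Lemma ker_liftE (k : kernel f) Z (g : hom Z X) (fg0 : f \oc g = 0) :
  ker_map k \oc ker_lift k fg0 = g.
Proof. exact: projT2 (cid (ker_lift_ex k fg0)). Qed.

End Lifts.

End PreadditiveTheory.

Record abelian := Abelian {
  ab_cat :> preadditive;
  ab_zero : exists Z : ab_cat, zero_object Z;
  ab_biproduct : forall X Y : ab_cat, exists S, biproduct X Y S;
  ab_ker : forall (X Y : ab_cat) (f : hom X Y), kernel f;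
  ab_coker : forall (X Y : ab_cat) (f : hom X Y), cokernel f;
  ab_mono : forall (X Y : ab_cat) (f : hom X Y), monic f ->
    exists (Z : ab_cat) (g : hom Y Z), is_kernel g f;
  ab_epi : forall (X Y : ab_cat) (f : hom X Y), epic f ->
    exists (Z : ab_cat) (g : hom Z X), is_cokernel g f
}.

Definition full_sub (B : preadditive) (P : B -> Prop) : preadditive :=
  @Preadditive {X : B | P X}
    (fun X Y => hom (sval X) (sval Y))
    (fun X => idm (sval X))
    (fun _ _ _ g f => g \oc f)
    (fun _ _ f => comp1m f) (fun _ _ f => compm1 f)
    (fun _ _ _ _ h g f => compA h g f)
    (fun _ _ _ g g' f => compDl g g' f)
    (fun _ _ _ g f f' => compDr g f f').

Section Subcategories.
Variables (B : preadditive) (C : B -> Prop).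

Definition additive_sub : Prop :=
  (exists Z : B, zero_object Z /\ C Z) /\
  (forall X Y, C X -> C Y -> exists S, biproduct X Y S /\ C S).

Definition strictly_full : Prop :=
  forall X Y : B, isomorphic X Y -> C X -> C Y.

Definition karoubi_closed : Prop :=
  forall X Y S : B, biproduct X Y S -> C S -> C X.

End Subcategories.

(* [i + 1], written so that it reduces on constructors. *)
Definition isucc (i : int) : int :=
  match i with
  | Posz n => Posz n.+1
  | Negz 0 => Posz 0
  | Negz n.+1 => Negz n
  end.

Lemma isuccE i : isucc i = i + 1.
Proof.
case: i => [n|[|n]] //=; first by rewrite -addn1 PoszD.
by rewrite !NegzE -[in RHS]addn1 PoszD opprD addrNK.
Qed.

Record complex (B : preadditive) := Complex {
  cx :> int -> B;
  dif : forall i, hom (cx i) (cx (isucc i));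
  dif2 : forall i, dif (isucc i) \oc dif i = 0
}.
Arguments dif {B} c i.

Section ChainMaps.
Variable B : preadditive.

Record chain_map (X Y : complex B) := ChainMap {
  cmap :> forall i, hom (X i) (Y i);
  cmapP : forall i, cmap (isucc i) \oc dif X i = dif Y i \oc cmap i
}.

Lemma chain_map_eq (X Y : complex B) (f g : chain_map X Y) :
  (forall i, f i = g i) -> f = g.
Proof.
case: f g => [f fP] [g gP] /= fg.
have E : f = g by apply: functional_extensionality_dep.
by case: _ / E gP => gP; congr ChainMap; apply: Prop_irrelevance.
Qed.

Section Zmodule.
Variables X Y : complex B.
Implicit Types f g : chain_map X Y.

Lemma zero_cmapP i :
  (0 : hom (X (isucc i)) (Y (isucc i))) \oc dif X i
    = dif Y i \oc (0 : hom (X i) (Y i)).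
Proof. by rewrite comp0m compm0. Qed.
Definition zero_cmap : chain_map X Y := ChainMap zero_cmapP.

Lemma opp_cmapP f i :
  (- f (isucc i)) \oc dif X i = dif Y i \oc (- f i).
Proof. by rewrite compNm compmN cmapP. Qed.
Definition opp_cmap f : chain_map X Y := ChainMap (opp_cmapP f).

Lemma add_cmapP f g i :
  (f (isucc i) + g (isucc i)) \oc dif X i = dif Y i \oc (f i + g i).
Proof. by rewrite compDl compDr !cmapP. Qed.
Definition add_cmap f g : chain_map X Y := ChainMap (add_cmapP f g).

HB.instance Definition _ := gen_eqMixin (chain_map X Y).
HB.instance Definition _ := gen_choiceMixin (chain_map X Y).

Lemma add_cmapA : associative add_cmap.
Proof. by move=> f g h; apply: chain_map_eq => i /=; rewrite addrA. Qed.
Lemma add_cmapC : commutative add_cmap.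
Proof. by move=> f g; apply: chain_map_eq => i /=; rewrite addrC. Qed.
Lemma add_0cmap : left_id zero_cmap add_cmap.
Proof. by move=> f; apply: chain_map_eq => i /=; rewrite add0r. Qed.
Lemma add_Ncmap : left_inverse zero_cmap opp_cmap add_cmap.
Proof. by move=> f; apply: chain_map_eq => i /=; rewrite addNr. Qed.

HB.instance Definition _ := GRing.isZmodule.Build (chain_map X Y)
  add_cmapA add_cmapC add_0cmap add_Ncmap.

(* [h i] is the component [X^(i+1) -> Y^i]; every degree is of the form
   [isucc i], so the equation below is required in all degrees. *)
Definition null_homotopic f : Prop :=
  exists h : forall i, hom (X (isucc i)) (Y i),
    forall i, f (isucc i) = dif Y i \oc h i + h (isucc i) \oc dif X (isucc i).

Definition null_htp : {pred chain_map X Y} := fun f => `[< null_homotopic f >].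

Lemma null_htp_zmod : zmod_closed null_htp.
Proof.
split=> [|f g /asboolP[h hE] /asboolP[k kE]]; apply/asboolP.
  by exists (fun=> 0) => i; rewrite comp0m compm0 addr0.
exists (fun i => h i - k i) => i /=.
by rewrite hE kE compDl compDr compNm compmN opprD addrACA.
Qed.

HB.instance Definition _ := GRing.isZmodClosed.Build _ null_htp null_htp_zmod.

Definition homK : zmodType := Quotient.quot null_htp.

End Zmodule.

Lemma id_cmapP (X : complex B) i :
  idm (X (isucc i)) \oc dif X i = dif X i \oc idm (X i).
Proof. by rewrite comp1m compm1. Qed.
Definition id_cmap (X : complex B) : chain_map X X := ChainMap (@id_cmapP X).

Lemma comp_cmapP (X Y Z : complex B) (g : chain_map Y Z) (f : chain_map X Y) i :
  (g (isucc i) \oc f (isucc i)) \oc dif X i = dif Z i \oc (g i \oc f i).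
Proof. by rewrite -compA cmapP compA cmapP compA. Qed.
Definition comp_cmap (X Y Z : complex B) (g : chain_map Y Z) (f : chain_map X Y) :
  chain_map X Z := ChainMap (comp_cmapP g f).

Definition htp_class (X Y : complex B) (f : chain_map X Y) : homK X Y :=
  (\pi_(Quotient.quot (null_htp (Y:=Y))) f)%qT.

Definition idK (X : complex B) : homK X X := htp_class (id_cmap X).

Definition compK (X Y Z : complex B) (g : homK Y Z) (f : homK X Y) : homK X Z :=
  htp_class (comp_cmap (repr g) (repr f)).

Lemma htp_classP (X Y : complex B) (f g : chain_map X Y) :
  htp_class f = htp_class g <-> null_homotopic (f - g).
Proof.
rewrite /htp_class; split=> [/eqP|fg].
  by rewrite -Quotient.idealrBE => /asboolP.
by apply/eqP; rewrite -Quotient.idealrBE; apply/asboolP.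
Qed.

Lemma htp_class_repr (X Y : complex B) (f : homK X Y) : htp_class (repr f) = f.
Proof. exact: reprK. Qed.

Lemma htp_classD (X Y : complex B) (f g : chain_map X Y) :
  htp_class (f + g) = htp_class f + htp_class g.
Proof. exact: (raddfD (\pi_(Quotient.quot (null_htp (Y:=Y))))%qT). Qed.

Lemma comp_cmapDl (X Y Z : complex B) (g g' : chain_map Y Z) (f : chain_map X Y) :
  comp_cmap (g + g') f = comp_cmap g f + comp_cmap g' f.
Proof. by apply: chain_map_eq => i /=; rewrite compDl. Qed.

Lemma comp_cmapDr (X Y Z : complex B) (g : chain_map Y Z) (f f' : chain_map X Y) :
  comp_cmap g (f + f') = comp_cmap g f + comp_cmap g f'.
Proof. by apply: chain_map_eq => i /=; rewrite compDr. Qed.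

Lemma null_homotopic_compl (X Y Z : complex B) (g : chain_map Y Z)
    (f : chain_map X Y) : null_homotopic f -> null_homotopic (comp_cmap g f).
Proof.
case=> h hE; exists (fun i => g i \oc h i) => i /=.
by rewrite hE compDr !compA cmapP.
Qed.

Lemma null_homotopic_compr (X Y Z : complex B) (g : chain_map Y Z)
    (f : chain_map X Y) : null_homotopic g -> null_homotopic (comp_cmap g f).
Proof.
case=> h hE; exists (fun i => h i \oc f (isucc i)) => i /=.
by rewrite hE compDl -!compA cmapP.
Qed.

Lemma htp_class_comp (X Y Z : complex B) (g : chain_map Y Z) (f : chain_map X Y) :
  compK (htp_class g) (htp_class f) = htp_class (comp_cmap g f).
Proof.
rewrite /compK; set g' := repr _; set f' := repr _.
have /htp_classP g'g : htp_class g' = htp_class g by exact: htp_class_repr.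
have /htp_classP f'f : htp_class f' = htp_class f by exact: htp_class_repr.
transitivity (htp_class (comp_cmap g' f)); apply/htp_classP.
  have -> : comp_cmap g' f' - comp_cmap g' f = comp_cmap g' (f' - f).
    by apply/eqP; rewrite subr_eq -comp_cmapDr subrK.
  exact: null_homotopic_compl.
have -> : comp_cmap g' f - comp_cmap g f = comp_cmap (g' - g) f.
  by apply/eqP; rewrite subr_eq -comp_cmapDl subrK.
exact: null_homotopic_compr.
Qed.

Lemma compK1m (X Y : complex B) (f : homK X Y) : compK (idK Y) f = f.
Proof.
rewrite -[f]htp_class_repr htp_class_comp; congr htp_class.
by apply: chain_map_eq => i /=; rewrite comp1m.
Qed.

Lemma compKm1 (X Y : complex B) (f : homK X Y) : compK f (idK X) = f.
Proof.
rewrite -[f]htp_class_repr htp_class_comp; congr htp_class.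
by apply: chain_map_eq => i /=; rewrite compm1.
Qed.

Lemma compKA (X Y Z W : complex B) (h : homK Z W) (g : homK Y Z) (f : homK X Y) :
  compK h (compK g f) = compK (compK h g) f.
Proof.
rewrite -[f]htp_class_repr -[g]htp_class_repr -[h]htp_class_repr.
rewrite !htp_class_comp; congr htp_class.
by apply: chain_map_eq => i /=; rewrite compA.
Qed.

Lemma compKDl (X Y Z : complex B) (g g' : homK Y Z) (f : homK X Y) :
  compK (g + g') f = compK g f + compK g' f.
Proof.
rewrite -[f]htp_class_repr -[g]htp_class_repr -[g']htp_class_repr.
by rewrite -htp_classD !htp_class_comp -htp_classD comp_cmapDl.
Qed.

Lemma compKDr (X Y Z : complex B) (g : homK Y Z) (f f' : homK X Y) :
  compK g (f + f') = compK g f + compK g f'.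
Proof.
rewrite -[f]htp_class_repr -[f']htp_class_repr -[g]htp_class_repr.
by rewrite -htp_classD !htp_class_comp -htp_classD comp_cmapDr.
Qed.

(* [K(B)]; its bounded above part [K^-(B)] is [Kminus B]. *)
Definition Kcat : preadditive :=
  Preadditive compK1m compKm1 compKA compKDl compKDr.

Definition bounded_above (X : complex B) : Prop :=
  exists N : int, forall i, N < i -> zero_object (X i).

Lemma shift_dif2 (X : complex B) i :
  (- dif X (isucc (isucc i))) \oc (- dif X (isucc i)) = 0.
Proof. by rewrite compNm compmN opprK dif2. Qed.

Definition shift (X : complex B) : complex B :=
  @Complex B (fun i => X (isucc i)) (fun i => - dif X (isucc i))
    (shift_dif2 X).

Lemma shift_bounded (X : complex B) : bounded_above X -> bounded_above (shift X).
Proof.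
case=> N XN; exists N => i Ni; apply: XN.
by rewrite isuccE (lt_trans Ni) // ltrDl.
Qed.

Definition Kminus : preadditive := @full_sub Kcat bounded_above.

Definition shiftK (X : Kminus) : Kminus :=
  exist bounded_above (shift (sval X)) (shift_bounded (svalP X)).

End ChainMaps.
Arguments Kminus B : clear implicits.

Section Cohomology.
Variable A : abelian.

(* Cocycles, coboundaries and cohomology in degree [isucc i]. *)
Definition cocycles (X : complex A) (i : int) : kernel (dif X (isucc i)) :=
  ab_ker (dif X (isucc i)).

Definition coboundary (X : complex A) (i : int) :
  hom (X i) (ker_ob (cocycles X i)) := ker_lift (cocycles X i) (dif2 X i).

Definition cohomology (X : complex A) (i : int) : cokernel (coboundary X i) :=
  ab_coker (coboundary X i).

Definition induced (X Y : complex A) (f : chain_map X Y) (i : int)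
    (u : hom (coker_ob (cohomology X i)) (coker_ob (cohomology Y i))) : Prop :=
  exists z : hom (ker_ob (cocycles X i)) (ker_ob (cocycles Y i)),
    ker_map (cocycles Y i) \oc z = f (isucc i) \oc ker_map (cocycles X i) /\
    u \oc coker_map (cohomology X i) = coker_map (cohomology Y i) \oc z.

(* [induced f u] determines [u]: it is the map induced by [f] on cohomology. *)
Definition quasi_iso (X Y : complex A) (f : chain_map X Y) : Prop :=
  forall i, exists u, induced f (i:=i) u /\ is_iso u.

End Cohomology.

Section Approximation.
Variables (A : abelian) (C : A -> Prop).

(* [K^-(C)], as a full subcategory of [K^-(A)]. *)
Definition in_TC (X : Kminus A) : Prop := forall i, C (sval X i).

Definition TC : preadditive := full_sub in_TC.

Definition C_approximation (XC X : Kminus A) (phi : hom XC X) : Prop :=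
  [/\ in_TC XC,
      exists f : chain_map (sval XC) (sval X), quasi_iso f /\ htp_class f = phi
    & forall Z : Kminus A, in_TC Z ->
        bijective (fun g : hom Z XC => phi \oc g)].

Definition approximating : Prop :=
  forall X : Kminus A, exists XC (phi : hom XC X), C_approximation phi.

Definition TC_shift (X : TC) : TC :=
  exist in_TC (shiftK (sval X)) (fun i => svalP X (isucc i)).

Definition TC_term (X : TC) (i : int) : A := sval (sval X) i.

Definition TC_le0 (X : TC) : Prop :=
  exists Y : TC, (forall i : int, 0 < i -> zero_object (TC_term Y i)) /\
    isomorphic X Y.

Definition TC_ge0 (X : TC) : Prop :=
  forall Y : TC, TC_le0 Y -> forall f : hom (TC_shift Y) X, f = 0.

Definition heart : preadditive := full_sub (fun X : TC => TC_le0 X /\ TC_ge0 X).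

End Approximation.

(* The set of natural numbers together with infinity, [None]. *)
Definition enat := option nat.

Definition enat_le (x y : enat) : Prop :=
  match x, y with
  | _, None => True
  | None, Some _ => False
  | Some m, Some n => (m <= n)%N
  end.

Lemma asbool_ex (P : nat -> Prop) :
  (exists n, P n) -> exists n, (fun n => `[< P n >]) n.
Proof. by case=> n Pn; exists n; apply/asboolP. Qed.

Definition enat_min (P : nat -> Prop) : enat :=
  match pselect (exists n, P n) with
  | left exP => Some (ex_minn (asbool_ex exP))
  | right _ => None
  end.

Definition enat_sup (S : enat -> Prop) : enat :=
  enat_min (fun n => forall x, S x -> enat_le x (Some n)).

(* The sequence [M, E 0, E 1, ...]. *)
Definition aug (B : preadditive) (M : B) (E : nat -> B) (k : nat) : B :=
  if k is k'.+1 then E k' else M.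

Section CDimension.
Variables (A : abelian) (C : A -> Prop).

(* [E k] is the term [C^{-k}]; [d 0] is the augmentation [C^0 -> M]. *)
Definition C_resolution (M : A) (E : nat -> A)
    (d : forall k, hom (aug M E k.+1) (aug M E k)) : Prop :=
  [/\ forall k, C (E k),
      epic (d 0%N) /\ (forall k, exact (d k.+1) (d k)),
      forall X, C X -> forall g : hom X M, exists h : hom X (E 0%N), d 0%N \oc h = g
    & forall X, C X -> forall k (g : hom X (aug M E k.+1)),
        d k \oc g = 0 -> exists h : hom X (aug M E k.+2), d k.+1 \oc h = g].

Definition C_dim_ob (M : A) : enat :=
  enat_min (fun n => exists E d, @C_resolution M E d /\
    forall k, (n < k)%N -> zero_object (E k)).

Definition C_dim : enat := enat_sup (fun x => exists M, x = C_dim_ob M).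

End CDimension.

Section Yoneda.
Variable B : preadditive.

(* Exact sequences [0 -> Y -> E n -> ... -> E 0 -> X -> 0], of degree [n.+1];
   the objects [E k] and maps [d k] with [k > n] are unconstrained. *)
Record extension (n : nat) (X Y : B) := Extension {
  ext_ob : nat -> B;
  ext_d : forall k, hom (aug X ext_ob k.+1) (aug X ext_ob k);
  ext_i : hom Y (ext_ob n);
  ext_epic : epic (ext_d 0%N);
  ext_exact : forall k, (k < n)%N -> exact (ext_d k.+1) (ext_d k);
  ext_exact_i : exact ext_i (ext_d n);
  ext_monic : monic ext_i
}.
Arguments ext_d {n X Y} e k.

Definition ext_morphism (n : nat) (X Y : B) (E F : extension n X Y) : Prop :=
  exists phi : forall k, hom (aug X (ext_ob E) k) (aug X (ext_ob F) k),
    [/\ phi 0%N = idm X,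
        forall k, (k <= n)%N -> ext_d F k \oc phi k.+1 = phi k \oc ext_d E k
      & phi n.+1 \oc ext_i E = ext_i F].

Definition yoneda_equiv (n : nat) (X Y : B) : relation (extension n X Y) :=
  clos_refl_sym_trans _ (@ext_morphism n X Y).

(* [Ext^m(X, Y)] is the group of Yoneda classes, which is nonzero iff it has at
   least two elements. *)
Definition Ext_nonzero (m : nat) (X Y : B) : Prop :=
  match m with
  | 0 => exists f : hom X Y, f <> 0
  | n.+1 => exists E F : extension n X Y, ~ yoneda_equiv E F
  end.

Definition cohomological_dim : enat :=
  enat_sup (fun x => exists m (X Y : B), Ext_nonzero m X Y /\ x = Some m).

End Yoneda.

(* Main.v *)
(* By the approximation property every object of A is an epimorphic image of an
   object of C through which all maps from C factor. Hence the heart consists, up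
   to isomorphism, of the complexes X in degrees <= 0 such that Hom(c, X) is exact
   in negative degrees for c in C, and it has enough projectives, the objects of C
   in degree 0. If c1 -> c0 is the end of X, a C-resolution of length n of the
   kernel of c1 -> c0 prolongs it to a projective resolution of X of length n + 2,
   so that all Yoneda extensions of X of higher degree are trivial.

   Conversely, a C-resolution E of M is a projective resolution of the object of
   the heart presented by E 1 -> E 0. If all extensions of degree n + 1 are
   trivial, so is the one defined by the resolution itself, truncated at its
   (n+1)-st syzygy; this yields s : E n -> E n+1 with d s d = d, and the image of
   the idempotent 1 - d s, which lies in C, ends a C-resolution of M of length n. *)
From mathcomp Require Import all_boot all_algebra boolp.
From Stdlib Require Import Relations.
Require Import Defs.

Set Implicit Arguments.
Unset Strict Implicit.
Unset Printing Implicit Defensive.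

Import GRing.Theory.
Local Open Scope ring_scope.
Local Open Scope cat_scope.

(** Builds chain maps and homotopies one degree at a time; [G] is the invariant that makes the next
    component exist. *)
Lemma dependent_choice (T : nat -> Type) (G : forall k, T k -> Prop)
    (R : forall k, T k -> T k.+1 -> Prop) (x0 : T 0) :
  G 0 x0 -> (forall k x, G k x -> exists y, R k x y /\ G k.+1 y) ->
  exists s : forall k, T k, s 0 = x0 /\ forall k, R k (s k) (s k.+1).
Proof.
move=> G0 step.
pose next k (x : {x : T k | G k x}) : {y : T k.+1 | G k.+1 y} :=
  let y := cid (step k _ (svalP x)) in exist _ (sval y) (proj2 (svalP y)).
pose s := fix s k : {x : T k | G k x} :=
  if k is k'.+1 then next k' (s k') else exist _ x0 G0.
exists (fun k => sval (s k)); split=> // k /=.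
exact: (proj1 (svalP (cid (step k _ (svalP (s k)))))).
Qed.

(** * Epimorphisms, monomorphisms and kernels in a preadditive category *)

Section Preadditive.
Variable B : preadditive.

Lemma compBl (X Y Z : B) (g g' : hom Y Z) (f : hom X Y) :
  (g - g') \oc f = g \oc f - g' \oc f.
Proof. by rewrite compDl compNm. Qed.

Lemma compBr (X Y Z : B) (g : hom Y Z) (f f' : hom X Y) :
  g \oc (f - f') = g \oc f - g \oc f'.
Proof. by rewrite compDr compmN. Qed.

Lemma epic0P (X Y : B) (f : hom X Y) :
  epic f <-> forall Z (g : hom Y Z), g \oc f = 0 -> g = 0.
Proof.
split=> [ef Z g gf0|ef Z g h gh]; first by apply: ef; rewrite gf0 comp0m.
by apply/eqP; rewrite -subr_eq0; apply/eqP/ef; rewrite compBl gh subrr.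
Qed.

Lemma monic0P (X Y : B) (f : hom X Y) :
  monic f <-> forall Z (g : hom Z X), f \oc g = 0 -> g = 0.
Proof.
split=> [mf Z g gf0|mf Z g h gh]; first by apply: mf; rewrite gf0 compm0.
by apply/eqP; rewrite -subr_eq0; apply/eqP/mf; rewrite compBr gh subrr.
Qed.

Lemma epic_id (X : B) : epic (idm X).
Proof. by move=> Z g h; rewrite !compm1. Qed.

Lemma monic_id (X : B) : monic (idm X).
Proof. by move=> Z g h; rewrite !comp1m. Qed.

Lemma epic_comp (X Y Z : B) (g : hom Y Z) (f : hom X Y) :
  epic g -> epic f -> epic (g \oc f).
Proof. by move=> eg ef W a b; rewrite !compA => /ef /eg. Qed.

Lemma epic_compr (X Y Z : B) (g : hom Y Z) (f : hom X Y) :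
  epic (g \oc f) -> epic g.
Proof. by move=> e W a b ab; apply: e; rewrite !compA ab. Qed.

Lemma monic_comp (X Y Z : B) (g : hom Y Z) (f : hom X Y) :
  monic g -> monic f -> monic (g \oc f).
Proof. by move=> mg mf W a b; rewrite -!compA => /mg /mf. Qed.

Lemma monic_compl (X Y Z : B) (g : hom Y Z) (f : hom X Y) :
  monic (g \oc f) -> monic f.
Proof. by move=> m W a b ab; apply: m; rewrite -!compA ab. Qed.

Lemma monic_section (X Y : B) (f : hom X Y) (r : hom Y X) :
  r \oc f = idm X -> monic f.
Proof. by move=> rf; apply: (@monic_compl _ _ _ r); rewrite rf; apply: monic_id. Qed.

Lemma epic_retraction (X Y : B) (f : hom X Y) (s : hom Y X) :
  f \oc s = idm Y -> epic f.
Proof. by move=> fs; apply: (@epic_compr _ _ _ _ s); rewrite fs; apply: epic_id. Qed.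

Lemma kernelP (X Y K : B) (f : hom X Y) (k : hom K X) :
  is_kernel f k <->
  [/\ f \oc k = 0, monic k
    & forall Z (g : hom Z X), f \oc g = 0 -> exists u : hom Z K, k \oc u = g].
Proof.
split=> [[fk0 univ]|[fk0 mk lift]]; split=> //.
- move=> Z g h gh.
  have [|u [_ uu]] := univ _ (k \oc g); first by rewrite compA fk0 comp0m.
  by rewrite -(uu g) // -(uu h).
- by move=> Z g /univ[u [uE _]]; exists u.
- by move=> Z g /lift[u uE]; exists u; split=> // v; rewrite -uE => /mk.
Qed.

Lemma exact_comp0 (X Y Z : B) (f : hom X Y) (g : hom Y Z) :
  exact f g -> g \oc f = 0.
Proof. by case=> K [k [e [[gk0 _] _ <-]]]; rewrite compA gk0 comp0m. Qed.

Lemma kernel_iff (X Y Z K : B) (f : hom X Y) (g : hom X Z) (k : hom K X) :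
  (forall W (u : hom W X), f \oc u = 0 <-> g \oc u = 0) ->
  is_kernel f k -> is_kernel g k.
Proof.
move=> fg [fk0 univ]; split; first exact/fg.
by move=> W u /fg; exact: univ.
Qed.

Lemma exact_id (X Y Z : B) (f : hom X Y) (g : hom Y Z) :
  is_kernel g f -> exact f g.
Proof. by exists X, f, (idm X); split=> //; [exact: epic_id|rewrite compm1]. Qed.

End Preadditive.

(** * Projective resolutions and Yoneda extensions *)

Section Projectives.
Variable B : preadditive.
Variable P : B -> Prop.

(* In the heart, [P] will be the class of the objects of [C] placed in degree
   [0]; a presentation is then the beginning of a [C]-resolution. *)
Definition presents (c1 c0 X : B) (f : hom c1 c0) (p : hom c0 X) : Prop :=
  [/\ epic p,
      p \oc f = 0,
      forall Z (g : hom c0 Z), g \oc f = 0 -> exists g' : hom X Z, g' \oc p = g,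
      forall x, P x -> forall u : hom x X, exists v : hom x c0, p \oc v = u
    & forall x, P x -> forall v : hom x c0, p \oc v = 0 ->
        exists w : hom x c1, f \oc w = v].

Hypothesis presented : forall X, exists c1 c0 (f : hom c1 c0) (p : hom c0 X),
  [/\ P c1, P c0 & presents f p].
Hypothesis presenting : forall c1 c0 (f : hom c1 c0), P c1 -> P c0 ->
  exists X (p : hom c0 X), presents f p.
Hypothesis P_biproduct : forall c c', P c -> P c' ->
  exists S, biproduct c c' S /\ P S.

(** Cover [X] by [q : x0 -> X] and lift [e \oc q] to [t : x0 -> y0]. The cokernel [r] of [(f, t)] on
    the sum of [y1] and [x0] is [r' \oc p], where [r'] kills the epimorphism [e \oc q]; so [r = 0].
    Hence maps from [P] to [y0] lift to the sum, and their part in [y1] dies in [Y]. *)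
Lemma projective (x X Y : B) (e : hom X Y) (u : hom x Y) :
  P x -> epic e -> exists v : hom x X, e \oc v = u.
Proof.
move=> Px ee.
have [y1 [y0 [f [p [Py1 Py0 [ep pf0 pcok plift _]]]]]] := presented Y.
have [_ [x0 [_ [q [_ Px0 [eq _ _ _ _]]]]]] := presented X.
have [t tE] := plift _ Px0 (e \oc q).
have [S [[i1 [i2 [p1 [p2 [e11 e22 e12 e21 eS]]]]] PS]] := P_biproduct Py1 Px0.
have [Q [r [_ rg0 _ _ rker]]] := presenting (f \oc p1 + t \oc p2) PS Py0.
have rf0 : r \oc f = 0.
  have := congr1 (fun h => h \oc i1) rg0.
  by rewrite /= comp0m -compA compDl -!compA e11 e21 compm0 addr0 compm1.
have rt0 : r \oc t = 0.
  have := congr1 (fun h => h \oc i2) rg0.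
  by rewrite /= comp0m -compA compDl -!compA e22 e12 compm0 add0r compm1.
have [r' r'E] := pcok _ _ rf0.
have r'0 : r' = 0.
  apply: (iffLR (epic0P _) ee); apply: (iffLR (epic0P _) eq).
  by rewrite -compA -tE compA r'E.
have [|w wE] := rker _ Py0 (idm y0); first by rewrite -r'E r'0 !comp0m.
have [v vE] := plift _ Px u.
exists (q \oc (p2 \oc w \oc v)).
rewrite compA -tE -[RHS]vE -[in RHS](comp1m v) -wE.
by rewrite compDl compDl -!compA compDr !compA pf0 !comp0m add0r.
Qed.

Lemma exact_lift (x X Y Z : B) (f : hom X Y) (g : hom Y Z) (u : hom x Y) :
  P x -> exact f g -> g \oc u = 0 -> exists v : hom x X, f \oc v = u.
Proof.
move=> Px [K [k [e [/kernelP[_ _ kl] ee <-]]]] /kl[w <-].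
by have [v <-] := projective w Px ee; exists v; rewrite compA.
Qed.

(** Every object is an epimorphic image of one in [P], and maps from [P] to [X] lift along [p], so
    monicity can be tested on maps from [P] to [c0]. *)
Lemma presents_monic (c1 c0 X Y : B) (f : hom c1 c0) (p : hom c0 X)
    (m : hom X Y) :
  presents f p ->
  (forall x, P x -> forall v : hom x c0, m \oc p \oc v = 0 ->
     exists w : hom x c1, f \oc w = v) ->
  monic m.
Proof.
move=> [_ pf0 _ plift _] H; apply/monic0P => Z g mg0.
have [_ [z0 [_ [q [_ Pz0 [eq _ _ _ _]]]]]] := presented Z.
apply: (iffLR (epic0P _) eq).
have [v vE] := plift _ Pz0 (g \oc q).
have [|w wE] := H _ Pz0 v; first by rewrite -compA vE compA mg0 comp0m.
by rewrite -vE -wE compA pf0 comp0m.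
Qed.

(** A test map from [W] is pulled back to a cover of [W], lifted to [c0], and descends again to [W]
    because [m] is monic. *)
Lemma presents_kernel (c1 c0 X Y Z : B) (f : hom c1 c0) (p : hom c0 X)
    (m : hom X Y) (d : hom Y Z) :
  presents f p -> monic m -> d \oc (m \oc p) = 0 ->
  (forall x, P x -> forall u : hom x Y, d \oc u = 0 ->
     exists v : hom x c0, m \oc p \oc v = u) ->
  is_kernel d m.
Proof.
move=> [ep pf0 _ plift _] mm dm0 H; apply/kernelP; split=> //.
  by apply: ep; rewrite -compA dm0 comp0m.
move=> W u du0.
have [w1 [w0 [g [q [Pw1 Pw0 [eq qg0 qcok _ _]]]]]] := presented W.
have [|v vE] := H _ Pw0 (u \oc q); first by rewrite compA du0 comp0m.
have [|t tE] := qcok _ (p \oc v).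
  by apply: mm; rewrite compm0 !compA vE -compA qg0 compm0.
by exists t; apply: eq; rewrite -compA tE compA.
Qed.

(** Constructed as the cokernel of the direct sum of presentations of [X] and [Y]. *)
Lemma biproduct_ex (X Y : B) : exists S, biproduct X Y S.
Proof.
have [x1 [x0 [f [p [Px1 Px0 [ep pf0 pcok _ _]]]]]] := presented X.
have [y1 [y0 [g [q [Py1 Py0 [eq qg0 qcok _ _]]]]]] := presented Y.
have [S0 [[i1 [i2 [p1 [p2 [e11 e22 e12 e21 eS]]]]] PS0]] := P_biproduct Px0 Py0.
have [S1 [[j1 [j2 [q1 [q2 [d11 d22 d12 d21 dS]]]]] PS1]] := P_biproduct Px1 Py1.
have [S [r [er rh0 rcok _ _]]] :=
  presenting (i1 \oc f \oc q1 + i2 \oc g \oc q2) PS1 PS0.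
have rf0 : r \oc i1 \oc f = 0.
  have := congr1 (fun h => h \oc j1) rh0.
  by rewrite /= comp0m -compA compDl -!compA d11 d21 !compm0 addr0 compm1.
have rg0 : r \oc i2 \oc g = 0.
  have := congr1 (fun h => h \oc j2) rh0.
  by rewrite /= comp0m -compA compDl -!compA d22 d12 !compm0 add0r compm1.
have [k1 k1E] := pcok _ _ rf0.
have [k2 k2E] := qcok _ _ rg0.
have [|r1 r1E] := rcok _ (p \oc p1).
  rewrite compDr !compA -[p \oc p1 \oc i1]compA e11 -[p \oc p1 \oc i2]compA e12.
  by rewrite compm1 pf0 compm0 !comp0m addr0.
have [|r2 r2E] := rcok _ (q \oc p2).
  rewrite compDr !compA -[q \oc p2 \oc i1]compA e21 -[q \oc p2 \oc i2]compA e22.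
  by rewrite compm1 qg0 compm0 !comp0m addr0.
exists S, k1, k2, r1, r2; split.
- by apply: ep; rewrite -compA k1E compA r1E -compA e11 compm1 comp1m.
- by apply: eq; rewrite -compA k2E compA r2E -compA e22 compm1 comp1m.
- by apply: eq; rewrite -compA k2E compA r1E -compA e12 compm0 comp0m.
- by apply: ep; rewrite -compA k1E compA r2E -compA e21 compm0 comp0m.
apply: er; rewrite compDl -!compA r1E r2E !compA k1E k2E comp1m -!compA.
by rewrite -compDr eS compm1.
Qed.

Section Resolution.
Variables (X : B) (c : nat -> B).
Variable D : forall k, hom (aug X c k.+1) (aug X c k).

Definition projective_resolution : Prop :=
  [/\ forall k, P (c k),
      presents (D 1) (D 0),
      forall k, D k \oc D k.+1 = 0
    & forall x, P x -> forall k (u : hom x (aug X c k.+1)), D k \oc u = 0 ->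
        exists v : hom x (aug X c k.+2), D k.+1 \oc v = u].

Hypothesis resD : projective_resolution.

(** As [B] is not assumed abelian, the image of [D k] is constructed as the cokernel of [D k.+1];
    exactness on maps from [P] makes it a subobject, the kernel of the preceding differential. For
    [k = 0] it is [X]. *)
Lemma syzygy k : exists K (q : hom (aug X c k.+1) K) (m : hom K (aug X c k)),
  [/\ m \oc q = D k, presents (D k.+1) q, monic m
    & match k return hom K (aug X c k) -> Prop with
      | 0 => fun=> True | j.+1 => is_kernel (D j) end m].
Proof.
have [Pc p0 DD Dex] := resD.
case: k => [|k].
  exists X, (D 0), (idm X); split=> //; first by rewrite comp1m.
  exact: monic_id.
have [K [q pq]] := presenting (D k.+2) (Pc k.+2) (Pc k.+1).
have [eq _ qcok _ _] := pq.
have [m mq] := qcok _ _ (DD k.+1).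
have mm : monic m.
  by apply: (presents_monic pq) => x Px v; rewrite mq; exact: Dex.
exists K, q, m; split=> //.
apply: (presents_kernel pq) => //; rewrite ?mq //.
by move=> x Px u; exact: Dex.
Qed.

Section Extensions.
Variables (n : nat) (Y : B).
Implicit Types E F : extension n X Y.

(** [l] is a comparison map from the resolution to [E] over the identity of [X], and [phi] is its
    last component, a cocycle of degree [n.+1] with values in [Y]. *)
Definition cocycle E (phi : hom (aug X c n.+2) Y) : Prop :=
  exists l : forall k, hom (aug X c k) (aug X (ext_ob E) k),
    [/\ l 0 = idm X,
        forall k, (k <= n)%N -> ext_d E k \oc l k.+1 = l k \oc D k
      & ext_i E \oc phi = l n.+1 \oc D n.+1].

Lemma cocycle_ex E : exists phi, cocycle E phi.
Proof.
have [Pc _ DD _] := resD.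
pose G k : hom (aug X c k) (aug X (ext_ob E) k) -> Prop :=
  match k with
  | 0 => fun=> True
  | k.+1 => fun x => (k <= n)%N -> ext_d E k \oc (x \oc D k.+1) = 0
  end.
pose R k (x : hom (aug X c k) (aug X (ext_ob E) k))
  (y : hom (aug X c k.+1) (aug X (ext_ob E) k.+1)) :=
  (k <= n)%N -> ext_d E k \oc y = x \oc D k.
have GR k x y : R k x y -> G k.+1 y.
  by move=> Rxy /Rxy xy; rewrite compA xy -compA DD compm0.
have [//||l [l0 lR]] := @dependent_choice _ G R (idm X).
  move=> k x Gx.
  suff [y Rxy] : exists y, R k x y by exists y; split=> //; apply: GR Rxy.
  (* The terms of [E] above degree [n] are unconstrained, so [R] is vacuous there and 0 serves. *)
  have [kn|nk] := leqP k n; last by exists 0; rewrite /R leqNgt nk.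
  case: k x Gx kn => [x _ _|k x Gx kn].
    have [y yE] := projective (x \oc D 0) (Pc 0) (ext_epic (e := E)).
    by exists y.
  have [y yE] := exact_lift (Pc k.+1) (ext_exact E kn) (Gx (ltnW kn)).
  by exists y.
have [|phi phiE] := exact_lift (u := l n.+1 \oc D n.+1) (Pc n.+1) (ext_exact_i E).
  by rewrite compA lR // -compA DD compm0.
by exists phi, l; split.
Qed.

Lemma cocycle_diff E phi phi' :
  cocycle E phi -> cocycle E phi' ->
  exists t : hom (aug X c n.+1) Y, phi - phi' = t \oc D n.+1.
Proof.
have [Pc _ DD _] := resD.
move=> [l [l0 lD lphi]] [l' [l'0 l'D l'phi]].
have dl k : (k <= n)%N ->
    ext_d E k \oc (l k.+1 - l' k.+1) = (l k - l' k) \oc D k.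
  by move=> kn; rewrite compBr compBl lD // l'D.
(* Components of a homotopy between [l] and [l']. The induction keeps only the homotopy equation
   composed with [D k], in which the contribution of the previous component vanishes. *)
have htp k : (k <= n)%N -> exists h : hom (aug X c k) (aug X (ext_ob E) k.+1),
    ext_d E k \oc (h \oc D k) = (l k - l' k) \oc D k.
  elim: k => [_|k IHk kn].
    by exists 0; rewrite l0 l'0 subrr !comp0m compm0.
  have [h hE] := IHk (ltnW kn).
  have [|h' h'E] := exact_lift (u := (l k.+1 - l' k.+1) - h \oc D k) (Pc k)
    (ext_exact E kn); first by rewrite compBr hE dl ?subrr // ltnW.
  by exists h'; rewrite compA h'E compBl -[h \oc D k \oc _]compA DD compm0 subr0.
have [h hE] := htp n (leqnn n).
have [|t tE] := exact_lift (u := (l n.+1 - l' n.+1) - h \oc D n) (Pc n)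
  (ext_exact_i E); first by rewrite compBr hE dl ?subrr.
exists t; apply: (ext_monic (e := E)).
rewrite compBr lphi l'phi compA tE !compBl.
by rewrite -[h \oc D n \oc _]compA DD compm0 subr0.
Qed.

Lemma cocycle_morphism E F phi :
  ext_morphism E F -> cocycle E phi -> cocycle F phi.
Proof.
move=> [g [g0 gd gi]] [l [l0 lD lphi]].
exists (fun k => g k \oc l k); split.
- by rewrite g0 l0 comp1m.
- by move=> k kn; rewrite compA gd // -compA lD // compA.
- by rewrite -gi -!compA lphi.
Qed.

(* Membership of [phi] in the class in [Ext^(n+1)(X, Y)] that [E] defines. *)
Definition ext_class E (phi : hom (aug X c n.+2) Y) : Prop :=
  exists phi' t, cocycle E phi' /\ phi = phi' + t \oc D n.+1.

(** A morphism of extensions carries cocycles forward. Conversely, a cocycle of the source is also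
    one of the target, so it differs from any given cocycle of the target by a coboundary. *)
Lemma ext_class_equiv E F phi :
  yoneda_equiv E F -> ext_class E phi <-> ext_class F phi.
Proof.
elim=> {E F} [E F EF|E|E F _ IH|E F H _ IH1 _ IH2] //; last 2 first.
- by split=> /IH.
- by split=> [/IH1 /IH2|/IH2 /IH1].
split=> [] [phi' [t [phi'P ->]]].
  by exists phi', t; split=> //; apply: cocycle_morphism phi'P.
have [psi psiP] := cocycle_ex E.
have [u uE] := cocycle_diff phi'P (cocycle_morphism EF psiP).
by exists psi, (u + t); split=> //; rewrite compDl -uE addrA addrCA subrr addr0.
Qed.

(* A factorization [aug X c k.+1 -> S -> aug X c k] of the differential, with
   a map [Y -> S]: below degree [n] the middle object is [c k], in degree [n]
   it is the sum of [Y] and the image of the differential. *)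
Record split_term k := SplitTerm {
  st_ob : B;
  st_in : hom (aug X c k.+1) st_ob;
  st_out : hom st_ob (aug X c k);
  st_i : hom Y st_ob
}.

(** The third and fourth clauses say that maps out of the term are determined by, and can be glued
    from, their restrictions along [st_in] and [st_i]. They have one form for all [k], so that a map
    out of the trivial extension is defined uniformly. *)
Definition split_term_spec k (t : split_term k) : Prop :=
  [/\ st_out t \oc st_in t = D k,
      st_out t \oc st_i t = 0,
      forall Z (a b : hom (st_ob t) Z),
        a \oc st_in t = b \oc st_in t -> a \oc st_i t = b \oc st_i t -> a = b
    & forall Z (a : hom (aug X c k.+1) Z) (b : hom Y Z),
        (k = n -> a \oc D k.+1 = 0) -> (k <> n -> b = 0) ->
        exists g, g \oc st_in t = a /\ g \oc st_i t = b] /\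
  if k == n then
    [/\ st_in t \oc D k.+1 = 0, is_kernel (st_out t) (st_i t) & monic (st_i t)]
  else is_iso (st_in t).

Lemma split_term_ex k : exists t : split_term k, split_term_spec t.
Proof.
have [_ _ DD _] := resD; rewrite /split_term_spec.
case: eqP => [kn|kn]; last first.
  exists (SplitTerm (idm _) (D k) 0) => /=; split.
    split=> //; rewrite ?compm1 ?compm0 // => Z a; first by move=> b; rewrite !compm1.
    by move=> b _ /(_ kn) ->; exists a; rewrite compm1 compm0.
  by exists (idm _); rewrite compm1.
have [K [q [m [mq [eq qD qcok _ _] mm _]]]] := syzygy k.
have [S [i1 [i2 [p1 [p2 [e11 e22 e12 e21 eS]]]]]] := biproduct_ex K Y.
exists (SplitTerm (i1 \oc q) (m \oc p1) i2) => /=; split.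
  split; rewrite -?compA ?e12 ?compm0 //.
  - by rewrite (compA p1) e11 comp1m mq.
  - move=> Z a b; rewrite !compA => /eq ab1 ab2.
    by rewrite -[a]compm1 -[b]compm1 -eS !compDr !compA ab1 ab2.
  - move=> Z a b /(_ kn) /qcok[a' <-] _; exists (a' \oc p1 + b \oc p2).
    rewrite !compDl -!compA (compA p1) e11 (compA p2) e21 e12 e22.
    by rewrite !comp0m !compm0 comp1m compm1 addr0 add0r.
split; [by rewrite -compA qD compm0| |exact: monic_section e22].
apply/kernelP; split; [by rewrite -compA e12 compm0|exact: monic_section e22|].
move=> Z g mg0; exists (p2 \oc g).
rewrite compA -[RHS]comp1m -eS compDl -[i1 \oc p1 \oc g]compA.
by rewrite (_ : p1 \oc g = 0) ?compm0 ?add0r //; apply: mm; rewrite compm0 compA.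
Qed.

(** [U] is the resolution below degree [n], closed off by the sum of a syzygy and [Y]. If [E] has
    the cocycle 0, the component [l n.+1] of its comparison map kills [D n.+1], hence factors
    through the syzygy; on [Y] one takes [ext_i E]. *)
Lemma trivial_extension_ex : exists U : extension n X Y,
  cocycle U 0 /\ forall E, cocycle E 0 -> ext_morphism U E.
Proof.
have [Pc [ep _ _ _ _] DD _] := resD.
pose t k := sval (cid (split_term_ex k)).
have tP k : split_term_spec (t k) := svalP (cid (split_term_ex k)).
pose S k := st_ob (t k).
have rD : st_in (t n) \oc D n.+1 = 0 by case: (tP n) => _; rewrite eqxx => -[].
have ik : is_kernel (st_out (t n)) (st_i (t n)).
  by case: (tP n) => _; rewrite eqxx => -[].
have im : monic (st_i (t n)) by case: (tP n) => _; rewrite eqxx => -[].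
have r_iso k : (k < n)%N -> is_iso (st_in (t k)).
  by move=> kn; case: (tP k) => _; rewrite ltn_eqF.
have r_mono k : (k < n)%N -> monic (st_in (t k)).
  by case/r_iso => r' [r'r _]; apply: monic_section r'r.
pose d k : hom (aug X S k.+1) (aug X S k) :=
  match k with
  | 0 => st_out (t 0)
  | k.+1 => st_in (t k) \oc st_out (t k.+1)
  end.
(* Below degree [n] the maps [st_in] are isomorphisms, so [d k] and [st_out] have the same
   kernel. *)
have d0P k W (u : hom W (S k)) : (k <= n)%N ->
    st_out (t k) \oc u = 0 <-> d k \oc u = 0.
  case: k u => [|k] u kn //=; rewrite -compA.
  split=> [->|]; first by rewrite compm0.
  by rewrite -[RHS](compm0 _ (st_in (t k))) => /r_mono; apply.
have d_epic : epic (d 0).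
  case: (tP 0) => -[rs _ _ _] _.
  by apply: (@epic_compr _ _ _ _ _ (st_in (t 0))); rewrite rs.
have d_exact k : (k < n)%N -> exact (d k.+1) (d k).
  move=> kn; have [r' [r'r rr']] := r_iso k kn.
  have [[sr si _ _] _] := tP k; have [[sr' si' JE _] _] := tP k.+1.
  (* [st_out] corestricts to a map [e] to the kernel [K] of [D k], epic because [e \oc st_in = q]
     already is. *)
  have [K [q [m [mq [eq _ _ _ _] mm /= /kernelP[Dm _ Dl]]]]] := syzygy k.+1.
  have [|e eE] := Dl _ (st_out (t k.+1)).
    by apply: JE; rewrite comp0m -compA ?sr' ?DD // si' compm0.
  exists K, (st_in (t k) \oc m), e; split.
  - apply/kernelP; split.
    + by apply/(d0P _ _ _ (ltnW kn)); rewrite compA sr Dm.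
    + by apply: monic_comp mm; apply: r_mono.
    + move=> Z g /(d0P _ _ _ (ltnW kn)) sg.
      have [|u uE] := Dl _ (r' \oc g).
        by rewrite -sr -compA (compA (st_in _)) rr' comp1m.
      by exists u; rewrite -compA uE compA rr' comp1m.
  - apply: (@epic_compr _ _ _ _ _ (st_in (t k.+1))).
    suff -> : e \oc st_in (t k.+1) = q by [].
    by apply: mm; rewrite compA eE sr' mq.
  - by rewrite /= -compA eE.
have d_exact_i : exact (st_i (t n)) (d n).
  by apply: exact_id; apply: kernel_iff ik => W u; apply: d0P.
exists (Extension d_epic d_exact d_exact_i im); split.
  exists (fun k => match k return hom (aug X c k) (aug X S k) with
                   | 0 => idm X | k.+1 => st_in (t k) end); split=> //=.
    move=> k _; have [[sr _ _ _] _] := tP k.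
    by case: k sr => [|k] /= sr; rewrite ?comp1m // -compA sr.
  by rewrite rD compm0.
move=> E [l [l0 lD]]; rewrite compm0 => /esym lDn.
(* [dfwith] puts [ext_i E] in degree [n] and 0 elsewhere, as the gluing clause of [split_term_spec]
   requires. *)
pose b k : hom Y (ext_ob E k) := dfwith (fun k => 0 : hom Y (ext_ob E k)) (ext_i E) k.
have bn : b n = ext_i E by rewrite /b dfwith_in.
have b0 k : k <> n -> b k = 0 by move=> /eqP kn; rewrite /b dfwith_out // eq_sym.
have gP k : exists g : hom (S k) (ext_ob E k),
    g \oc st_in (t k) = l k.+1 /\ g \oc st_i (t k) = b k.
  have [[_ _ _ UP] _] := tP k; apply: UP => [kn|]; last exact: b0.
  by rewrite kn.
pose g k := sval (cid (gP k)).
have [gr gi] : (forall k, g k \oc st_in (t k) = l k.+1) /\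
    (forall k, g k \oc st_i (t k) = b k).
  by split=> k; case: (svalP (cid (gP k))).
exists (fun k => match k return hom (aug X S k) (aug X (ext_ob E) k) with
                 | 0 => idm X | k.+1 => g k end); split=> //=; last first.
  by rewrite gi bn.
move=> k kn; have [[sr si JE _] _] := tP k.
have -> : match k return hom (aug X S k) (aug X (ext_ob E) k) with
          | 0 => idm X | k.+1 => g k end \oc d k = l k \oc st_out (t k).
  by case: (k) => [|j] /=; [rewrite l0|rewrite compA gr].
apply: JE; rewrite -!compA; first by rewrite gr sr lD.
rewrite gi si compm0; have [->|/eqP kn'] := eqVneq k n.
  by rewrite bn; exact: exact_comp0 (ext_exact_i E).
by rewrite b0 // compm0.
Qed.

(** With [c n.+1] zero, 0 is a cocycle of every extension, so the trivial extension maps to both [E]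
    and [F]. *)
Lemma ext_trivial_length :
  idm (aug X c n.+2) = 0 -> forall E F, yoneda_equiv E F.
Proof.
move=> c0 E F; have [U [_ UE]] := trivial_extension_ex.
have z E' : cocycle E' 0.
  have [phi phiP] := cocycle_ex E'.
  by rewrite (_ : 0 = phi) // -[phi]compm1 c0 compm0.
apply: rst_trans (rst_step _ _ _ _ (UE _ (z F))).
by apply: rst_sym; apply: rst_step; exact: UE.
Qed.

End Extensions.

(** The resolution cut off at the image [K] of [D n.+1] is an extension with cocycle [q]. As it is
    equivalent to the trivial one, [q = t \oc D n.+1] for some [t] from [c n] to [K]; lifting [t]
    along [q] gives [s]. *)
Lemma ext_trivial_regular n :
  (forall Y (E F : extension n X Y), yoneda_equiv E F) ->
  exists s : hom (aug X c n.+1) (aug X c n.+2),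
    D n.+1 \oc s \oc D n.+1 = D n.+1.
Proof.
move=> triv; have [Pc [ep _ _ _ _] DD _] := resD.
have Dexact k : exact (D k.+1) (D k).
  by have [K [q [m [mq [eq _ _ _ _] _ km]]]] := syzygy k.+1; exists K, m, q.
have [K [q [m [mq [eq qD _ qlift _] mm km]]]] := syzygy n.+1.
pose E := @Extension B n X K c D m ep (fun k _ => Dexact k) (exact_id km) mm.
have Eq : ext_class E q.
  exists q, 0; rewrite comp0m addr0; split=> //.
  exists (fun k => idm (aug X c k)); split=> // [k _|].
    by rewrite comp1m compm1.
  by rewrite comp1m.
have [U [U0 _]] := @trivial_extension_ex n K.
have [phi [u [phiU qE]]] := iffLR (ext_class_equiv _ (triv _ E U)) Eq.
have [v vE] := cocycle_diff phiU U0.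
have [s sE] := qlift _ (Pc n) (u + v).
exists s; rewrite -mq -!compA (compA q) sE; congr (_ \oc _).
by rewrite mq compDl -vE subr0 addrC -qE.
Qed.

End Resolution.
End Projectives.
(** * C-resolutions *)

Section Complexes.
Variable B : preadditive.

Lemma htp_class0 (X Y : complex B) : htp_class (0 : chain_map X Y) = 0.
Proof. by apply: (addrI (htp_class 0)); rewrite -htp_classD !addr0. Qed.

Lemma htp_class_eq0 (X Y : complex B) (f : chain_map X Y) :
  htp_class f = 0 <-> null_homotopic f.
Proof. by rewrite -htp_class0 htp_classP subr0. Qed.

Variable Z : B.
Hypothesis zZ : zero_object Z.

Definition single (c : B) : complex B :=
  @Complex B (fun i => if i is Posz 0 then c else Z) (fun=> 0)
    (fun i => comp0m _ _).

Lemma single_bounded c : bounded_above (single c).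
Proof. by exists 0 => -[[|n]|n]. Qed.

Definition single_out (c : B) (Y : complex B) (v : hom c (Y (Posz 0)))
    (dv : dif Y (Posz 0) \oc v = 0) : chain_map (single c) Y.
Proof.
exists (fun i => match i return hom (single c i) (Y i) with
                 | Posz 0 => v | _ => 0 end).
by move=> [[|n]|[|n]] /=; rewrite ?compm0.
Defined.

Lemma single_cocycle c (Y : complex B) (f : chain_map (single c) Y) :
  dif Y (Posz 0) \oc f (Posz 0) = 0.
Proof. by rewrite -cmapP compm0. Qed.

(** Only the homotopy component out of degree 0 can be nonzero, so homotopy classes of maps
    [single c -> Y] form the degree 0 cohomology of Hom(c, Y). *)
Lemma single_null c (Y : complex B) (f : chain_map (single c) Y) :
  null_homotopic f <-> exists w : hom c (Y (Negz 0)), dif Y (Negz 0) \oc w = f (Posz 0).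
Proof.
split=> [[h /(_ (Negz 0)) /= ->]|[w wE]].
  by exists (h (Negz 0)); rewrite compm0 addr0.
exists (fun i => match i return hom (single c (isucc i)) (Y i) with
                 | Negz 0 => w | _ => 0 end).
move=> [n|[|n]] /=; rewrite !compm0 addr0 //; exact: (proj1 zZ).
Qed.

Section Truncation.
Variable X : complex B.

Lemma truncation_dif2 i : let T j := if j is Posz n.+1 then X j else Z in
  let d j := match j return hom (T j) (T (isucc j)) with
             | Posz n.+1 => dif X (Posz n.+1) | _ => 0 end in
  d (isucc i) \oc d i = 0.
Proof. by case: i => [[|n]|[|n]] /=; rewrite ?compm0 //; apply: (dif2 X (Posz n.+1)). Qed.

Definition truncation : complex B := Complex truncation_dif2.

Definition truncation_map : chain_map truncation X.
Proof.
exists (fun i => match i return hom (truncation i) (X i) with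
                 | Posz n.+1 => idm _ | _ => 0 end).
by move=> [[|n]|[|n]] /=; rewrite ?comp1m ?compm1 ?compm0.
Defined.

Lemma truncation_bounded : bounded_above X -> bounded_above truncation.
Proof. by case=> N XN; exists N => -[[|n]|n] //=; exact: XN. Qed.

End Truncation.
End Complexes.

(** * Right approximations by [C] and resolutions *)

Section Approximations.
Variables (A : abelian) (C : A -> Prop).
Hypotheses (C_karoubi : karoubi_closed C) (C_approximating : approximating C).
Variable Z : A.
Hypotheses (zZ : zero_object Z) (CZ : C Z).

(** The complement that Karoubi closedness asks for is the kernel of [r]. *)
Lemma retract_closed (X S : A) (i : hom X S) (r : hom S X) :
  r \oc i = idm X -> C S -> C X.
Proof.
move=> ri CS; have [K k /kernelP[rk0 mk kl]] := ab_ker r.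
have [|p pE] := kl _ (idm S - i \oc r).
  by rewrite compBr compA ri compm1 comp1m subrr.
apply: (@C_karoubi X K S _ CS); exists i, k, r, p; split=> //.
- by apply: mk; rewrite compA pE compBl -compA rk0 compm0 comp1m compm1 subr0.
- by apply: mk; rewrite compA pE compBl -compA ri compm1 comp1m compm0 subrr.
- by rewrite pE addrC subrK.
Qed.

(* Let [f : X -> M] be a [C]-approximation of [M]. The inclusion of the brutal
   truncation of [X] in degrees [> 0] is killed by [f], hence null-homotopic,
   which makes the kernel of [X^0 -> X^1] a retract of [X^0]. *)
Lemma right_approximation (M : A) : exists c (g : hom c M),
  [/\ C c, epic g & forall x, C x -> forall u : hom x M,
        exists v : hom x c, g \oc v = u].
Proof.
have zS (W : A) (a b : hom Z W) : a = b by apply: (proj1 zZ).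
have zT (W : A) (a b : hom W Z) : a = b by apply: (proj2 zZ).
pose DM : Kminus A := exist (@bounded_above A) (single Z M) (single_bounded zZ M).
have [XC [phi [XC_C [f [qf fphi]] bij]]] := C_approximating DM.
pose X := sval XC.
pose T : Kminus A := exist (@bounded_above A) (truncation Z X)
  (truncation_bounded zZ (svalP XC)).
have TC : in_TC C T by move=> [[|n]|n]; [exact: CZ|exact: XC_C|exact: CZ].
pose j := truncation_map Z X.
have /htp_class_eq0[h hE] : htp_class j = 0.
  apply: (bij_inj (bij T TC)).
  rewrite -fphi; change (compK (htp_class f) (htp_class j) = compK (htp_class f) 0).
  rewrite -[in RHS]htp_class0 !htp_class_comp; congr htp_class.
  by apply: chain_map_eq => -[[|n]|n] //=; rewrite !compm0.
(* The homotopy equation in degree 1, composed with the differential [d] of degree 0, gives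
   [d = d \oc h \oc d], so [1 - h \oc d] projects [X^0] onto the kernel of [d]. *)
have {hE} d0 : dif X (Posz 0) = dif X (Posz 0) \oc (h (Posz 0) \oc dif X (Posz 0)).
  have /= hE0 := hE (Posz 0).
  rewrite -[LHS]comp1m hE0 compDl -!compA.
  by rewrite (dif2 X (Posz 0)) compm0 addr0.
have [u [[z [zE uE]] [u' [u'u uu']]]] := qf (Negz 0).
have [kd0 mk kl] := iffLR (kernelP _ _) (ker_mapP (cocycles X (Negz 0))).
set k := ker_map (cocycles X (Negz 0)) in zE kd0 mk kl.
set kM := ker_map (cocycles (single Z M) (Negz 0)) in zE.
exists (ker_ob (cocycles X (Negz 0))), (f (Posz 0) \oc k); split.
- have [|r rE] := kl _ (idm _ - h (Posz 0) \oc dif X (Posz 0)).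
    by rewrite compBr compm1 -d0 subrr.
  apply: (@retract_closed _ (X (Posz 0)) k r); last exact: XC_C.
  apply: mk; rewrite compA rE compBl comp1m compm1 -compA.
  by rewrite (_ : dif X (Posz 0) \oc k = 0) ?compm0 ?subr0.
- set q := coker_map (cohomology X (Negz 0)) in uE.
  set qM := coker_map (cohomology (single Z M) (Negz 0)) in uE.
  have eq' (W W' : A) (b : hom W W') (Q : cokernel b) : epic (coker_map Q).
    apply/epic0P => V a a0.
    have [_ /(_ V 0 (comp0m _ _))[v [_ vU]]] := coker_mapP Q.
    by rewrite -(vU a) // -(vU 0) // comp0m.
  (* The degree 0 cohomology of the stalk complex is [M]: [w] is a left inverse of [qM], and [t]
     below is a section of [kM]. Surjectivity of [f] on cohomology thus makes [f \oc k] epic. *)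
  have [_ /(_ _ (idm _)) []] := coker_mapP (cohomology (single Z M) (Negz 0)).
    by rewrite comp1m; exact: zS.
  move=> w [wq _].
  have [_ _ /(_ _ (idm M)) [|t tE]] :=
    iffLR (kernelP _ _) (ker_mapP (cocycles (single Z M) (Negz 0))).
    exact: comp0m.
  move=> W a b; rewrite -zE !compA => ab.
  have ewz : epic (qM \oc z).
    by rewrite -uE; apply: epic_comp; [exact: epic_retraction uu'|exact: eq'].
  have : a \oc kM \oc w = b \oc kM \oc w.
    by apply: ewz; rewrite !compA -!(compA _ w qM) wq !compm1.
  move/(congr1 (fun e => e \oc qM)); rewrite /= -!compA wq !compm1.
  move/(congr1 (fun e => e \oc t)); rewrite /= -!compA.
  by rewrite (_ : kM \oc t = idm M) // !compm1.
- move=> x Cx g.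
  pose Dx : Kminus A := exist (@bounded_above A) (single Z x) (single_bounded zZ x).
  have DxC : in_TC C Dx by move=> [[|n]|n]; [exact: Cx|exact: CZ|exact: CZ].
  pose G : chain_map (single Z x) (single Z M) :=
    @single_out _ Z x (single Z M) g (comp0m _ _).
  have [b _ bK] := bij Dx DxC.
  have := bK (htp_class G); rewrite -[b _]htp_class_repr -fphi.
  set v := repr _.
  change (compK (htp_class f) (htp_class v) = htp_class G ->
    exists v0, f (Posz 0) \oc k \oc v0 = g).
  (* Both stalk complexes have zero differentials, so homotopic maps between them agree in degree
     0. *)
  rewrite htp_class_comp => /htp_classP[s /(_ (Negz 0)) /=].
  rewrite comp0m compm0 addr0 => /eqP; rewrite subr_eq0 => /eqP fv.
  have [|v' v'E] := kl _ (v (Posz 0)).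
    exact: single_cocycle.
  by exists v'; rewrite -compA v'E.
Qed.

(** Exactness at [W] of Hom(x, V) -> Hom(x, W) -> Hom(x, X) for [x] in [C], apart from
    [g \oc f = 0]. *)
Definition C_lifting (V W X : A) (f : hom V W) (g : hom W X) : Prop :=
  forall x, C x -> forall u : hom x W, g \oc u = 0 ->
    exists v : hom x V, f \oc v = u.

(** A right approximation of [W] is epic and, by hypothesis, factors through [f]. *)
Lemma lifting_epic (V W : A) (f : hom V W) :
  (forall x, C x -> forall u : hom x W, exists v, f \oc v = u) -> epic f.
Proof.
have [c [g [Cc eg _]]] := right_approximation W.
by move=> /(_ c Cc g)[v vE]; apply: (@epic_compr _ _ _ _ _ v); rewrite vE.
Qed.

Lemma lifting_exact (V W X : A) (f : hom V W) (g : hom W X) :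
  g \oc f = 0 -> C_lifting f g -> exact f g.
Proof.
move=> gf0 fg; have [K k kP] := ab_ker g; have [gk0 mk kl] := iffLR (kernelP _ _) kP.
have [e eE] := kl _ _ gf0.
exists K, k, e; split=> //; apply: lifting_epic => x Cx u.
have [|v vE] := fg x Cx (k \oc u); first by rewrite compA gk0 comp0m.
by exists v; apply: mk; rewrite compA eE.
Qed.

Lemma weak_kernel (V W : A) (g : hom V W) : exists c (t : hom c V),
  [/\ C c, g \oc t = 0 & C_lifting t g].
Proof.
have [K k /kernelP[gk0 mk kl]] := ab_ker g.
have [c [t [Cc _ tl]]] := right_approximation K.
exists c, (k \oc t); split=> //; first by rewrite compA gk0 comp0m.
move=> x Cx u /kl[u' <-]; have [v <-] := tl x Cx u'.
by exists v; rewrite compA.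
Qed.

Lemma resolve (V W : A) (g : hom V W) :
  exists E (d : forall k, hom (aug V E k.+1) (aug V E k)),
    [/\ forall k, C (E k), g \oc d 0 = 0 /\ C_lifting (d 0) g,
        forall k, d k \oc d k.+1 = 0 & forall k, C_lifting (d k.+1) (d k)].
Proof.
(* Arrows are packed with their end points, so that taking weak kernels becomes an endofunction to
   iterate. *)
pose arrow := {V : A & {W : A & hom V W}}.
pose arr (a : arrow) := projT2 (projT2 a).
have [ker kerP] := choice (fun a : arrow => weak_kernel (arr a)).
pose map a := sval (cid (kerP a)).
have mapP a : [/\ C (ker a), arr a \oc map a = 0 & C_lifting (map a) (arr a)].
  exact: svalP (cid (kerP a)).
clearbody map.
pose next a : arrow := existT _ (ker a) (existT _ (projT1 a) (map a)).
pose s k := iter k next (existT _ V (existT _ W g)).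
pose E k := projT1 (s k.+1).
exists E, (fun k => match k return hom (aug V E k.+1) (aug V E k) with
                    | 0 => map (s 0) | k.+1 => map (s k.+1) end).
split=> [k||k|k].
- by have [] := mapP (s k).
- by have [] := mapP (s 0).
- by have [_ + _] := mapP (s k.+1); case: k.
- by have [_ _] := mapP (s k.+1); case: k.
Qed.

Lemma lifting_resolution (M : A) (E : nat -> A)
    (d : forall k, hom (aug M E k.+1) (aug M E k)) :
  (forall k, C (E k)) ->
  (forall x, C x -> forall u : hom x M, exists v, d 0 \oc v = u) ->
  (forall k, d k \oc d k.+1 = 0) -> (forall k, C_lifting (d k.+1) (d k)) ->
  C_resolution C d.
Proof.
move=> CE d0 dd dl; split=> //.
- by split=> [|k]; [exact: lifting_epic|exact: lifting_exact].
- by move=> x Cx k u; exact: dl.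
Qed.

Section FiniteResolution.
Variables (M : A) (E : nat -> A).
Variable d : forall k, hom (aug M E k.+1) (aug M E k).
Hypothesis CE : forall k, C (E k).
Hypothesis d0_lift : forall x, C x -> forall u : hom x M, exists v, d 0 \oc v = u.
Hypothesis dd : forall k, d k \oc d k.+1 = 0.
Hypothesis d_lift : forall k, C_lifting (d k.+1) (d k).

Variables (n : nat) (s : hom (aug M E n.+1) (aug M E n.+2)).
Hypothesis d_regular : d n.+1 \oc s \oc d n.+1 = d n.+1.

(* [1 - d n.+1 \oc s] is idempotent on [E n]; its image [S n] is a complement
   to the image of [d n.+1]. *)
Lemma truncated_term k : exists S (r : hom (E k) S) (j : hom S (E k)),
  [/\ C S, r \oc j = idm S, (k <= n)%N -> d k \oc (j \oc r) = d k &
  [/\ (k < n)%N -> j \oc r = idm (E k),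
      k = n -> forall x, C x -> forall u : hom x (E k), d k \oc u = 0 -> r \oc u = 0
    & (n < k)%N -> zero_object S]].
Proof.
have [kn|kn|->] := ltngtP k n.
- exists (E k), (idm _), (idm _); split; rewrite ?compm1 //.
  by split=> // kn'; rewrite kn' ltnn in kn.
- exists Z, 0, 0; split=> //; first by apply: (proj1 zZ).
  by split=> // kn'; rewrite kn' ltnn in kn.
have [S j /kernelP[ej0 mj jl]] := ab_ker (d n.+1 \oc s).
have [|r rE] := jl _ (idm _ - d n.+1 \oc s).
  by rewrite compBr compm1 compA d_regular subrr.
have rj : r \oc j = idm S.
  by apply: mj; rewrite compA rE compBl ej0 subr0 comp1m compm1.
exists S, r, j; split=> //.
- by apply: retract_closed rj (CE n).
- by rewrite rE compBr compm1 compA dd comp0m subr0.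
split=> // _ x Cx u /(d_lift Cx)[v <-].
by apply: mj; rewrite compm0 compA rE compBl comp1m compA d_regular subrr.
Qed.

(** On [S n] the map [d n] has the same image as on [E n] and is injective on maps from [C], so the
    resolution may stop there. The pairs [r], [j] treat the degrees below, at and above [n]
    alike. *)
Lemma finite_resolution : exists S (d' : forall k, hom (aug M S k.+1) (aug M S k)),
  C_resolution C d' /\ forall k, (n < k)%N -> zero_object (S k).
Proof.
pose S k := sval (cid (truncated_term k)).
pose P1 k := svalP (cid (truncated_term k)).
pose r k : hom (E k) (S k) := sval (cid (P1 k)).
pose P2 k := svalP (cid (P1 k)).
pose j k : hom (S k) (E k) := sval (cid (P2 k)).
have SP k : [/\ C (S k), r k \oc j k = idm (S k),
    (k <= n)%N -> d k \oc (j k \oc r k) = d k &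
  [/\ (k < n)%N -> j k \oc r k = idm (E k),
      k = n -> forall x, C x -> forall u : hom x (E k), d k \oc u = 0 -> r k \oc u = 0
    & (n < k)%N -> zero_object (S k)]] := svalP (cid (P2 k)).
clearbody r j; clearbody S; clear P1 P2.
pose d' k : hom (aug M S k.+1) (aug M S k) :=
  match k with 0 => d 0 \oc j 0 | k.+1 => r k \oc d k.+1 \oc j k.+1 end.
have d'P k x (u : hom x (S k)) : (k <= n)%N -> d' k \oc u = 0 -> d k \oc (j k \oc u) = 0.
  case: k u => [|k] u kn /=; first by rewrite compA.
  have [_ _ _ [jr _ _]] := SP k.
  move/(congr1 (fun e => j k \oc e)).
  by rewrite compm0 !compA jr // comp1m -!compA.
exists S, d'; split; last by move=> k; have [_ _ _ []] := SP k.
apply: lifting_resolution => [k|x Cx u|k|k x Cx u].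
- by case: (SP k).
- have [v vE] := d0_lift Cx u; exists (r 0 \oc v).
  have [_ _ dj _] := SP 0.
  by rewrite /= -compA (compA _ _ v) compA dj.
- have [kn|nk] := ltnP k n; last first.
    have [_ _ _ [_ _ /(_ nk)[/= z _]]] := SP k.+1; exact: z.
  have [_ _ _ [jr _ _]] := SP k.
  rewrite /= -!compA.
  case: k kn jr => [|k] kn jr /=.
    by rewrite -compA (compA (j 0)) jr // comp1m compA dd comp0m.
  by rewrite -!compA (compA (j _)) jr // comp1m (compA (d k.+1)) dd comp0m compm0.
- have [_ rj _ [jr rn zS]] := SP k; have [_ _ dj' _] := SP k.+1.
  move=> d'u; have [kn|nk|kn] := ltngtP k n.
  + have [v vE] := d_lift Cx (d'P _ _ _ (ltnW kn) d'u).
    exists (r k.+1 \oc v).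
    rewrite /= -!compA (compA _ _ v) (compA (d _)) dj' // vE compA rj comp1m //.
  + by exists 0; apply: (proj2 (zS nk)).
  + exists 0; rewrite compm0 -[u]comp1m -rj -compA.
    by rewrite (rn kn _ Cx) //; apply: d'P => //; rewrite kn.
Qed.

End FiniteResolution.
End Approximations.

Lemma htp_class_surj (B : preadditive) (X Y : complex B) (a : homK X Y) :
  exists f, a = htp_class f.
Proof. by exists (repr a); rewrite htp_class_repr. Qed.

(** * The heart *)

Lemma presents_iso (B : preadditive) (P : B -> Prop) (c1 c0 X Y : B)
    (f : hom c1 c0) (p : hom c0 X) (a : hom X Y) :
  is_iso a -> presents P f p -> presents P f (a \oc p).
Proof.
case=> b [ba ab] [ep pf0 pcok plift pex]; split.
- by apply: epic_comp ep; apply: epic_retraction ab.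
- by rewrite -compA pf0 compm0.
- move=> Z g /pcok[g' g'E]; exists (g' \oc b).
  by rewrite compA -(compA g') ba compm1.
- move=> x Px u; have [v vE] := plift x Px (b \oc u).
  by exists v; rewrite -compA vE compA ab comp1m.
- move=> x Px v apv0; apply: pex => //.
  by rewrite -[p \oc v]comp1m -ba -compA (compA a) apv0 compm0.
Qed.

Section Shift.
Variable B : preadditive.

Lemma shift_mapP (X Y : complex B) (f : chain_map X Y) i :
  f (isucc (isucc i)) \oc dif (shift X) i = dif (shift Y) i \oc f (isucc i).
Proof. by rewrite /= compmN compNm cmapP. Qed.

Definition shift_map (X Y : complex B) (f : chain_map X Y) :
  chain_map (shift X) (shift Y) :=
  @ChainMap _ (shift X) (shift Y) (fun i => f (isucc i)) (shift_mapP f).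

Lemma shift_map_class (X Y : complex B) (f g : chain_map X Y) :
  htp_class f = htp_class g -> htp_class (shift_map f) = htp_class (shift_map g).
Proof.
(* The sign compensates the negated differential of [shift]. *)
move=> /htp_classP[h hE]; apply/htp_classP; exists (fun i => - h (isucc i)) => i.
by rewrite /= !compNm !compmN !opprK; exact: hE.
Qed.

End Shift.

(** * Normal complexes and the maps into them *)

Section NormalComplexes.
Variables (A : abelian) (C : A -> Prop).

Definition nonpositive (X : complex A) : Prop :=
  (forall i, C (X i)) /\ (forall n, zero_object (X (Posz n.+1))).

(* [k : nat] indexes the degrees [-k-1]: the complexes [Hom(x, Y)] with [x] in
   [C] have cohomology in degree [0] only. *)
Definition normal (Y : complex A) : Prop :=
  nonpositive Y /\ forall k, C_lifting C (dif Y (Negz k.+1)) (dif Y (Negz k)).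

Lemma nonpositive_bounded X : nonpositive X -> bounded_above X.
Proof. by case=> _ X0; exists 0 => -[[|n]|n]. Qed.

(** The comparison argument for projective resolutions: [h0] is continued downwards, since [X] has
    its terms in [C] and [Y] is exact in negative degrees for maps from [C]. *)
Lemma normal_null_homotopic (X Y : complex A) (g : chain_map X Y)
    (h0 : hom (X (Posz 0)) (Y (Negz 0))) :
  nonpositive X -> normal Y -> dif Y (Negz 0) \oc h0 = g (Posz 0) ->
  null_homotopic g.
Proof.
move=> [CX X0] [_ Yl] h0E.
pose T k := hom (X (isucc (Negz k))) (Y (Negz k)) : Type.
pose G k (x : T k) := dif Y (Negz k) \oc (x \oc dif X (Negz k)) =
  g (isucc (Negz k)) \oc dif X (Negz k).
pose R k (x : T k) (y : T k.+1) :=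
  dif Y (Negz k.+1) \oc y = g (Negz k) - x \oc dif X (Negz k).
have [||s [s0 sR]] := @dependent_choice T G R h0.
- by rewrite /G compA h0E.
- move=> k x Gx; have [|y yE] := Yl k _ (CX _) (g (Negz k) - x \oc dif X (Negz k)).
    by rewrite compBr Gx cmapP subrr.
  exists y; split=> //; rewrite /G compA yE compBl -compA.
  by rewrite (dif2 X (Negz k.+1)) compm0 subr0.
exists (fun i => match i return hom (X (isucc i)) (Y i) with
                 | Posz _ => 0 | Negz k => s k end).
move=> [n|[|k]]; first by apply: (proj1 (X0 n)).
  by rewrite /= s0 comp0m addr0.
by rewrite /= sR subrK.
Qed.

(** [v1] only starts the downward lifting; up to homotopy, [g] depends on [v0] alone. *)
Lemma normal_extension (X Y : complex A) (v0 : hom (X (Posz 0)) (Y (Posz 0)))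
    (v1 : hom (X (Negz 0)) (Y (Negz 0))) :
  nonpositive X -> normal Y ->
  dif Y (Negz 0) \oc v1 = v0 \oc dif X (Negz 0) ->
  exists g : chain_map X Y, g (Posz 0) = v0.
Proof.
move=> [CX X0] [[CY Y0] Yl] v1E.
pose T k := hom (X (Negz k)) (Y (Negz k)) : Type.
pose G k (x : T k) := dif Y (Negz k) \oc (x \oc dif X (Negz k.+1)) = 0.
pose R k (x : T k) (y : T k.+1) :=
  dif Y (Negz k.+1) \oc y = x \oc dif X (Negz k.+1).
have [||s [s0 sR]] := @dependent_choice T G R v1.
- by rewrite /G compA v1E -compA (dif2 X (Negz 1)) compm0.
- move=> k x /(Yl k _ (CX _))[y yE]; exists y; split=> //.
  by rewrite /G compA yE -compA (dif2 X (Negz k.+2)) compm0.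
have gP i : let g i := match i return hom (X i) (Y i) with
    | Posz 0 => v0 | Posz _ => 0 | Negz k => s k end in
  g (isucc i) \oc dif X i = dif Y i \oc g i.
  case: i => [[|n]|[|k]] /=; [exact: (proj2 (Y0 0))|exact: (proj2 (Y0 _))| |].
    by rewrite s0.
  exact: esym (sR k).
by exists (ChainMap gP).
Qed.

End NormalComplexes.


Lemma enat_min_le (P : nat -> Prop) n : P n -> enat_le (enat_min P) (Some n).
Proof.
move=> Pn; rewrite /enat_min; case: pselect => [exP|[]]; last by exists n.
by case: ex_minnP => m _ /(_ n); apply; apply/asboolP.
Qed.

Lemma enat_minP (P : nat -> Prop) n : enat_min P = Some n -> P n.
Proof.
rewrite /enat_min; case: pselect => // exP [<-].
by case: ex_minnP => m /asboolP.
Qed.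

(* [B] stands for [heart C], known only as a category of homotopy classes of
   maps between normal complexes: unfolding the heart down to [K^-(A)] makes
   conversion intractable. *)
Section NormalModel.
Variables (A : abelian) (C : A -> Prop).
Hypotheses (C_karoubi : karoubi_closed C) (C_approximating : approximating C).
Variable Z : A.
Hypotheses (zZ : zero_object Z) (CZ : C Z).
Variable B : preadditive.
Variable ob_of : forall Y : complex A, normal C Y -> B.
Variable of_chain : forall (Y Y' : complex A) (nY : normal C Y) (nY' : normal C Y'),
  chain_map Y Y' -> hom (ob_of nY) (ob_of nY').
Hypothesis ob_of_normal : forall H : B,
  exists Y (nY : normal C Y), isomorphic (ob_of nY) H.
Hypothesis of_chain_surj : forall Y Y' (nY : normal C Y) (nY' : normal C Y')
  (a : hom (ob_of nY) (ob_of nY')), exists f, a = of_chain nY nY' f.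
Hypothesis of_chain_comp : forall Y Y' Y''
  (nY : normal C Y) (nY' : normal C Y') (nY'' : normal C Y'')
  (g : chain_map Y' Y'') (f : chain_map Y Y'),
  of_chain nY' nY'' g \oc of_chain nY nY' f = of_chain nY nY'' (comp_cmap g f).
Hypothesis of_chain_id : forall Y (nY : normal C Y),
  of_chain nY nY (id_cmap Y) = idm (ob_of nY).
Hypothesis of_chainD : forall Y Y' (nY : normal C Y) (nY' : normal C Y')
  (f g : chain_map Y Y'),
  of_chain nY nY' (f + g) = of_chain nY nY' f + of_chain nY nY' g.
Hypothesis of_chain_eq0 : forall Y Y' (nY : normal C Y) (nY' : normal C Y')
  (f : chain_map Y Y'), of_chain nY nY' f = 0 <-> null_homotopic f.

(** * Stalk complexes of objects of [C] as projectives *)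

Lemma single_normal c : C c -> normal C (single Z c).
Proof.
move=> Cc; split; first by split=> [[[|n]|n]|n].
by move=> k x Cx u _; exists 0; apply: (proj2 zZ).
Qed.

Definition stalk c (Cc : C c) : B := ob_of (single_normal Cc).

Definition stalk_chain c c' (v : hom c c') : chain_map (single Z c) (single Z c') :=
  @single_out _ Z c (single Z c') v (comp0m _ _).

Definition stalk_map c c' (Cc : C c) (Cc' : C c') (v : hom c c') :
  hom (stalk Cc) (stalk Cc') := of_chain _ _ (stalk_chain v).

Lemma single_chain_eq c (Y : complex A) (f g : chain_map (single Z c) Y) :
  f (Posz 0) = g (Posz 0) -> f = g.
Proof.
move=> fg; apply: chain_map_eq => -[[|n]|n] //=; exact: (proj1 zZ).
Qed.

Section StalkMap.
Variables (c c' c'' : A) (Cc : C c) (Cc' : C c') (Cc'' : C c'').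

Lemma stalk_map_surj (a : hom (stalk Cc) (stalk Cc')) :
  exists v, a = stalk_map Cc Cc' v.
Proof.
have [f ->] := of_chain_surj a; exists (f (Posz 0)).
by congr of_chain; exact: single_chain_eq.
Qed.

Lemma stalk_map_comp (g : hom c' c'') (f : hom c c') :
  stalk_map Cc' Cc'' g \oc stalk_map Cc Cc' f = stalk_map Cc Cc'' (g \oc f).
Proof. by rewrite /stalk_map of_chain_comp; congr of_chain; exact: single_chain_eq. Qed.

Lemma stalk_map_id : stalk_map Cc Cc (idm c) = idm (stalk Cc).
Proof. by rewrite -of_chain_id; congr of_chain; exact: single_chain_eq. Qed.

Lemma stalk_mapD (f g : hom c c') :
  stalk_map Cc Cc' (f + g) = stalk_map Cc Cc' f + stalk_map Cc Cc' g.
Proof. by rewrite -of_chainD; congr of_chain; exact: single_chain_eq. Qed.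

Lemma stalk_map_eq0 (f : hom c c') : stalk_map Cc Cc' f = 0 <-> f = 0.
Proof.
rewrite /stalk_map of_chain_eq0 (single_null zZ) /=.
split=> [[w <-]|->]; first by rewrite comp0m.
by exists 0; rewrite comp0m.
Qed.

End StalkMap.

Lemma stalk_map_inj c c' (Cc : C c) (Cc' : C c') : injective (@stalk_map c c' Cc Cc').
Proof.
move=> f g fg; apply/eqP; rewrite -subr_eq0; apply/eqP.
apply/(stalk_map_eq0 Cc Cc'); apply: (addIr (stalk_map Cc Cc' g)).
by rewrite -stalk_mapD subrK add0r.
Qed.

Definition is_stalk (H : B) : Prop := exists c (Cc : C c), H = stalk Cc.

(** [p] is the identity in degree 0. Maps from [Y] to normal complexes are determined up to homotopy
    by their degree 0 component and can be constructed from it, which gives the cokernel property;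
    maps from a stalk complex to [Y] are cocycles in degree 0. *)
Lemma normal_presents Y (nY : normal C Y) :
  let C_ i : C (Y i) := proj1 (proj1 nY) i in
  exists p, presents is_stalk
    (stalk_map (C_ (Negz 0)) (C_ (Posz 0)) (dif Y (Negz 0)))
    (p : hom (stalk (C_ (Posz 0))) (ob_of nY)).
Proof.
move=> C_; have [[CY Y0] Yl] := nY.
pose pi := @single_out _ Z _ Y (idm _) (proj2 (Y0 0) _ _ _).
exists (of_chain _ _ pi); split.
- apply/epic0P => H g; have [N [nN [a [b [ba ab]]]]] := ob_of_normal H.
  have [f fE] := of_chain_surj (b \oc g).
  move/(congr1 (fun e => b \oc e)); rewrite /= compm0 compA fE of_chain_comp.
  move/of_chain_eq0/(single_null zZ) => /= [w]; rewrite compm1 => wE.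
  suff z : b \oc g = 0 by rewrite -[g]comp1m -ab -compA z compm0.
  by rewrite fE; apply/of_chain_eq0; exact: normal_null_homotopic (proj1 nY) nN wE.
- rewrite of_chain_comp; apply/of_chain_eq0/(single_null zZ).
  by exists (idm _); rewrite /= comp1m compm1.
- move=> H g; have [N [nN [a [b [ba ab]]]]] := ob_of_normal H.
  have [f fE] := of_chain_surj (b \oc g).
  move/(congr1 (fun e => b \oc e)); rewrite /= compm0 compA fE of_chain_comp.
  move/of_chain_eq0/(single_null zZ) => /= [w wE].
  have [g' g'E] := normal_extension (proj1 nY) nN wE.
  exists (a \oc of_chain _ _ g'); rewrite -compA of_chain_comp.
  rewrite -[g]comp1m -ab -compA fE; congr (_ \oc of_chain _ _ _).
  by apply: single_chain_eq; rewrite /= g'E compm1.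
- move=> _ [c [Cc ->]] u; have [f ->] := of_chain_surj u.
  exists (stalk_map Cc _ (f (Posz 0))); rewrite of_chain_comp.
  by congr of_chain; apply: single_chain_eq; rewrite /= comp1m.
- move=> _ [c [Cc ->]] v; have [f ->] := stalk_map_surj v.
  rewrite of_chain_comp => /of_chain_eq0/(single_null zZ) /= [w].
  by rewrite comp1m => <-; exists (stalk_map Cc _ w); rewrite stalk_map_comp.
Qed.

Lemma stalk_presented (H : B) :
  exists c1 c0 (f : hom c1 c0) (p : hom c0 H),
    [/\ is_stalk c1, is_stalk c0 & presents is_stalk f p].
Proof.
have [Y [nY [a aP]]] := ob_of_normal H.
have [p pP] := normal_presents nY.
do 4 eexists; split; [by do 2 eexists|by do 2 eexists|].
exact: presents_iso aP pP.
Qed.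

(** Iterated weak kernels prolong [f0] to the left to a normal complex, which [f0] then presents. *)
Lemma stalk_presenting c1 c0 (f : hom c1 c0) : is_stalk c1 -> is_stalk c0 ->
  exists H (p : hom c0 H), presents is_stalk f p.
Proof.
move=> s1 s0; case: s1 f => c1' [Cc1 ->]; case: s0 => c0' [Cc0 ->] f.
have [f0 ->] := stalk_map_surj f.
have [E [d [CE [fd dlf] dd dl]]] :=
  resolve C_karoubi C_approximating zZ CZ f0.
pose T i := match i with Posz 0 => c0' | Posz _ => Z | Negz k => aug c1' E k end.
pose dT i : hom (T i) (T (isucc i)) := match i with
  | Posz _ => 0 | Negz 0 => f0 | Negz k.+1 => d k end.
have dT2 i : dT (isucc i) \oc dT i = 0.
  by case: i => [n|[|[|k]]]; [exact: comp0m|exact: comp0m|exact: fd|exact: dd].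
pose Y := Complex dT2.
have nY : normal C Y.
  split; first by split=> [[[|n]|[|k]]|n] /=.
  by case=> [|k]; [exact: dlf|exact: dl].
have [p pP] := normal_presents nY.
exists (ob_of nY).
by rewrite (Prop_irrelevance Cc0 (proj1 (proj1 nY) (Posz 0)))
  (Prop_irrelevance Cc1 (proj1 (proj1 nY) (Negz 0))); exists p.
Qed.

Hypothesis C_additive : additive_sub C.

Lemma stalk_biproduct (c c' : B) : is_stalk c -> is_stalk c' ->
  exists S, biproduct c c' S /\ is_stalk S.
Proof.
move=> [c0 [Cc ->]] [c0' [Cc' ->]].
have [S [[i1 [i2 [p1 [p2 [e11 e22 e12 e21 eS]]]]] CS]] := proj2 C_additive _ _ Cc Cc'.
exists (stalk CS); split; last by exists S, CS.
exists (stalk_map _ _ i1), (stalk_map _ _ i2), (stalk_map _ _ p1), (stalk_map _ _ p2).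
rewrite /is_biproduct !stalk_map_comp -stalk_mapD e11 e22 eS !stalk_map_id.
by split=> //; apply/stalk_map_eq0.
Qed.

Section StalkResolution.
Variables (X : B) (c : nat -> A) (Cc : forall k, C (c k)).
Variables (d : forall k, hom (c k.+1) (c k)).
Variable p : hom (stalk (Cc 0)) X.

Definition stalk_dif k :
    hom (aug X (fun k => stalk (Cc k)) k.+1) (aug X (fun k => stalk (Cc k)) k) :=
  if k is k.+1 then stalk_map (Cc k.+1) (Cc k) (d k) else p.

Lemma stalk_resolution :
  presents is_stalk (stalk_map (Cc 1) (Cc 0) (d 0)) p ->
  (forall k, d k \oc d k.+1 = 0) ->
  (forall k, C_lifting C (d k.+1) (d k)) ->
  projective_resolution is_stalk stalk_dif.
Proof.
move=> pP dd dl; split=> //.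
- by move=> k; exists (c k), (Cc k).
- by case=> [|k] /=; [case: pP|rewrite stalk_map_comp; apply/stalk_map_eq0].
move=> _ [x [Cx ->]] [|k] u /=.
  by case: pP => _ _ _ _ /(_ (stalk Cx)); apply; exists x, Cx.
have [v ->] := stalk_map_surj u; rewrite stalk_map_comp => /stalk_map_eq0.
by move=> /(dl k x Cx)[w <-]; exists (stalk_map _ _ w); rewrite stalk_map_comp.
Qed.

End StalkResolution.

(** * The two inequalities between the dimensions *)

Lemma cohomological_dim_le n :
  C_dim C = Some n -> enat_le (cohomological_dim B) (Some (n + 2)%N).
Proof.
move=> /enat_minP CdimP; apply: enat_min_le => _ [m [X [Y [mXY ->]]]] /=.
rewrite leqNgt; apply/negP => nm.
case: m nm mXY => [|m] //; rewrite addn2 ltnS => nm [E [F]]; apply.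
have [c1' [c0' [f [p [s1 s0 pP]]]]] := stalk_presented X.
case: s1 f pP => c1 [Cc1 ->]; case: s0 p => c0 [Cc0 ->] p f pP.
have [f0 f0E] := stalk_map_surj f; rewrite {f}f0E in pP.
have [K k /kernelP[fk0 mk kl]] := ab_ker f0.
have: enat_le (C_dim_ob C K) (Some n) by apply: CdimP; exists K.
case KE : (C_dim_ob C K) => [n'|] //= n'n.
have [G [d [[CG [ed de] d0l dl] G0]]] := enat_minP KE.
pose c := aug c0 (aug c1 G).
have Cc i : C (c i) by case: i => [|[|i]]; [exact: Cc0|exact: Cc1|exact: CG].
pose D i : hom (c i.+1) (c i) := match i with
  | 0 => f0 | 1 => k \oc d 0 | i.+2 => d i.+1 end.
have DD i : D i \oc D i.+1 = 0.
  case: i => [|[|i]] /=; first by rewrite compA fk0 comp0m.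
    by rewrite -compA (exact_comp0 (de 0)) compm0.
  exact: exact_comp0 (de i.+1).
have Dl i : C_lifting C (D i.+1) (D i).
  move=> x Cx u; case: i u => [|[|i]] u /=.
  - by case/kl => v <-; have [w <-] := d0l x Cx v; exists w; rewrite compA.
  - rewrite -compA => kdu; apply: dl => //.
    by apply: mk; rewrite kdu compm0.
  - exact: (dl x Cx i.+1 u).
rewrite (Prop_irrelevance Cc1 (Cc 1)) (Prop_irrelevance Cc0 (Cc 0)) in p pP.
have res := stalk_resolution pP DD Dl.
apply: (ext_trivial_length stalk_presented stalk_presenting stalk_biproduct res).
rewrite /= -stalk_map_id; apply/stalk_map_eq0.
(* Now [m] is at least [n + 2], so [c m.+1] is the term of [G] with index [m - 1], which exceeds
   [n]. *)
have zc : zero_object (c m.+1).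
  case: m nm {E F} => [|[|m]] // nm; apply: G0.
  exact: leq_ltn_trans n'n _.
exact: (proj1 zc).
Qed.

Lemma C_dim_le : enat_le (C_dim C) (cohomological_dim B).
Proof.
case cdE : (cohomological_dim B) => [n|]; last by case: (C_dim C).
have {cdE} cdP := enat_minP cdE.
apply: enat_min_le => _ [M ->]; apply: enat_min_le.
(* Every map to [M] is killed by the zero map, so resolving the latter makes all maps from [C] to
   [M] lift along [d 0]. *)
have [E [d [CE [_ d0] dd dl]]] :=
  resolve C_karoubi C_approximating zZ CZ (0 : hom M M).
have d0l x : C x -> forall u : hom x M, exists v, d 0 \oc v = u.
  by move=> Cx u; apply: d0 => //; rewrite comp0m.
have [X [p pP]] := stalk_presenting (stalk_map (CE 1) (CE 0) (d 1))
  (ex_intro _ _ (ex_intro _ _ erefl)) (ex_intro _ _ (ex_intro _ _ erefl)).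
have res := @stalk_resolution X E CE (fun k => d k.+1) p pP
  (fun k => dd k.+1) (fun k => dl k.+1).
have triv Y (G F : extension n X Y) : yoneda_equiv G F.
  (* Members of [extension n] have degree [n.+1], beyond the supremum [n]. *)
  apply: contrapT => GF.
  have : enat_le (Some n.+1) (Some n).
    by apply: cdP; exists n.+1, X, Y; split=> //; exists G, F.
  by rewrite /= ltnn.
have [s sE] := ext_trivial_regular stalk_presented stalk_presenting stalk_biproduct
  res triv.
(* Taking stalks is full and faithful on [C], so the equation comes down to [A]. *)
have [s0 s0E] := stalk_map_surj s; rewrite {s}s0E /= !stalk_map_comp in sE.
have [S [d' [d'P S0]]] := finite_resolution C_karoubi C_approximating zZ CZ CE
  d0l dd dl (stalk_map_inj sE).
by exists S, d'.
Qed.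

End NormalModel.

(* Identification of the heart with normal complexes *)
Opaque homK htp_class compK.

Section Heart.
Variables (A : abelian) (C : A -> Prop).
Hypotheses (C_karoubi : karoubi_closed C) (C_approximating : approximating C).
Variable Z : A.
Hypotheses (zZ : zero_object Z) (CZ : C Z).

Definition TC_of (X : complex A) (nX : nonpositive C X) : TC C :=
  exist (in_TC C) (exist _ X (nonpositive_bounded nX)) (proj1 nX).

Lemma TC_of_le0 X (nX : nonpositive C X) : TC_le0 (TC_of nX).
Proof.
exists (TC_of nX); split=> [[[|n]|n] //|]; first by move=> _; exact: (proj2 nX).
by exists (idm _), (idm _); rewrite comp1m.
Qed.

(** The shifted isomorphism replaces [X] by [X'], which lives in degrees <= 0. The shift of [X']
    vanishes in degree 0, so 0 starts a null-homotopy. *)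
Lemma normal_ge0 Y (nY : normal C Y) : TC_ge0 (TC_of (proj1 nY)).
Proof.
move=> X [X' [X'0 [a [b [ba ab]]]]] f.
pose cX := sval (sval X); pose cX' := sval (sval X').
have [fa faE] := @htp_class_surj _ cX cX' a.
have [fb fbE] := @htp_class_surj _ cX' cX b.
have ba1 : htp_class (comp_cmap fb fa) = htp_class (id_cmap cX).
  by rewrite -htp_class_comp -faE -fbE; exact: ba.
pose b' : hom (TC_shift X') (TC_shift X) := htp_class (shift_map fb).
pose a' : hom (TC_shift X) (TC_shift X') := htp_class (shift_map fa).
have ba' : b' \oc a' = idm _.
  change (compK (htp_class (shift_map fb)) (htp_class (shift_map fa))
    = idK (shift cX)).
  rewrite htp_class_comp; apply: etrans (etrans (shift_map_class ba1) _).
    by congr htp_class; exact: chain_map_eq.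
  by rewrite /idK; congr htp_class; exact: chain_map_eq.
suff z : f \oc b' = 0 by rewrite -[f]compm1 -ba' compA z comp0m.
have [g ->] := @htp_class_surj _ (shift cX') Y (f \oc b'); apply/htp_class_eq0.
apply: (@normal_null_homotopic _ C (shift cX') _ _ 0) => //.
  split=> [i|n]; first exact: (svalP X').
  exact: X'0.
by rewrite compm0; apply: (proj1 (X'0 (Posz 1) _)).
Qed.

Definition heart_of Y (nY : normal C Y) : heart C :=
  exist _ (TC_of (proj1 nY)) (conj (TC_of_le0 (proj1 nY)) (@normal_ge0 Y nY)).

(** Weak kernels [t k] of all differentials of a nonpositive representative [Y] assemble to one map
    [tau] from a shifted nonpositive complex. It vanishes up to homotopy by the defining property of
    [TC_ge0], so each [t k] factors through the preceding differential, and [Y] is normal. *)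
Lemma heart_normal (H : heart C) :
  exists Y (nY : normal C Y), isomorphic (heart_of nY) H.
Proof.
case: H => X [[Y [Y0 [a [b [ba ab]]]]] X_ge0].
pose cY := sval (sval Y).
have nonposY : nonpositive C cY.
  by split=> [|n]; [exact: (svalP Y)|exact: Y0].
have [c cP] := choice (fun k =>
  weak_kernel C_karoubi C_approximating zZ CZ (dif cY (Negz k))).
pose t k : hom (c k) (cY (Negz k)) := sval (cid (cP k)).
have tP k : [/\ C (c k), dif cY (Negz k) \oc t k = 0
    & C_lifting C (t k) (dif cY (Negz k))] := svalP (cid (cP k)).
clearbody t.
(* [shift T] has [c k] in degree [-k-1], the source of [dif cY (Negz k)]. *)
pose T := @Complex A (fun i => match i with
  | Posz 0 => c 0 | Posz _ => Z | Negz k => c k.+1 end) (fun=> 0) (fun=> comp0m _ _).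
have nT : nonpositive C T.
  by split=> // -[[|n]|k] //=; [case: (tP 0)|case: (tP k.+1)].
have tauP i : let tau i := match i return hom (shift T i) (cY i) with
    | Posz _ => 0 | Negz 0 => t 0 | Negz k.+1 => t k.+1 end in
  tau (isucc i) \oc dif (shift T) i = dif cY i \oc tau i.
  rewrite /= oppr0 compm0; case: i => [n|[|k]] /=; rewrite ?compm0 //.
    by case: (tP 0).
  by case: (tP k.+1).
pose tau := ChainMap tauP.
have : htp_class tau = 0.
  pose f : hom (TC_shift (TC_of nT)) Y := htp_class tau.
  have bf0 : b \oc f = 0 := X_ge0 _ (TC_of_le0 nT) _.
  by change (f = 0); rewrite -[f]comp1m -ab -compA bf0 compm0.
move/htp_class_eq0 => [h hE].
have wP k : exists w, dif cY (Negz k.+1) \oc w = t k.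
  exists (match k return hom (c k) (cY (Negz k.+1)) with
          | 0 => h (Negz 1) | k.+1 => h (Negz k.+2) end).
  (* As [T] has zero differential, only the term of the homotopy equation that ends with the
     differential of [Y] remains. *)
  have := hE (Negz k.+1); rewrite /= oppr0 compm0 addr0 => {hE}.
  by case: k.
have nY : normal C cY.
  split=> // k x Cx u; have [_ _ tl] := tP k => /(tl x Cx)[v <-].
  by have [w <-] := wP k; exists (w \oc v); rewrite compA.
by exists cY, nY, b, a.
Qed.

Definition heart_of_chain (Y Y' : complex A) (nY : normal C Y) (nY' : normal C Y')
  (f : chain_map Y Y') : hom (heart_of nY) (heart_of nY') := htp_class f.

Lemma heart_of_chain_surj (Y Y' : complex A) (nY : normal C Y) (nY' : normal C Y')
    (a : hom (heart_of nY) (heart_of nY')) :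
  exists f, a = heart_of_chain nY nY' f.
Proof. exact: (@htp_class_surj A Y Y' a). Qed.

Lemma heart_of_chain_id (Y : complex A) (nY : normal C Y) :
  heart_of_chain nY nY (id_cmap Y) = idm (heart_of nY).
Proof. by []. Qed.

Lemma heart_of_chain_comp (Y Y' Y'' : complex A)
    (nY : normal C Y) (nY' : normal C Y') (nY'' : normal C Y'')
    (g : chain_map Y' Y'') (f : chain_map Y Y') :
  heart_of_chain nY' nY'' g \oc heart_of_chain nY nY' f =
  heart_of_chain nY nY'' (comp_cmap g f).
Proof. exact: (@htp_class_comp A Y Y' Y''). Qed.

Lemma heart_of_chainD (Y Y' : complex A) (nY : normal C Y) (nY' : normal C Y')
    (f g : chain_map Y Y') :
  heart_of_chain nY nY' (f + g) = heart_of_chain nY nY' f + heart_of_chain nY nY' g.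
Proof. exact: (@htp_classD A Y Y'). Qed.

Lemma heart_of_chain_eq0 (Y Y' : complex A) (nY : normal C Y) (nY' : normal C Y')
    (f : chain_map Y Y') :
  heart_of_chain nY nY' f = 0 <-> null_homotopic f.
Proof. exact: (@htp_class_eq0 A Y Y'). Qed.

End Heart.

Theorem corollary3p18 (A : abelian) (C : ob A -> Prop)
    (C_additive : additive_sub C) (C_strictly_full : strictly_full C)
    (C_karoubi : karoubi_closed C) (C_approximating : approximating C) :
  (forall n : nat, C_dim C = Some n ->
     enat_le (cohomological_dim (heart C)) (Some (n + 2)%N)) /\
  enat_le (C_dim C) (cohomological_dim (heart C)).
Proof.
have [Z [zZ CZ]] := proj1 C_additive.
have hN := heart_normal C_karoubi C_approximating zZ CZ.
split=> [n|].
  exact: (cohomological_dim_le C_karoubi C_approximating zZ CZ hN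
    (@heart_of_chain_surj A C) (@heart_of_chain_comp A C) (@heart_of_chain_id A C)
    (@heart_of_chainD A C) (@heart_of_chain_eq0 A C) C_additive).
exact: (C_dim_le C_karoubi C_approximating zZ CZ hN
  (@heart_of_chain_surj A C) (@heart_of_chain_comp A C) (@heart_of_chain_id A C)
  (@heart_of_chainD A C) (@heart_of_chain_eq0 A C) C_additive).
Qed.
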